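(* Let $\beta_n$ denote the number of pairwise non-isomorphic $\tau$-retentive tournaments with $n$ vertices. Then $\beta_6=2$, $\beta_7=26$, $\beta_8\leq 395$, $\beta_9\leq 30596$ and $\beta_{10}\leq 3881175$.
   Context: A tournament $T$ consists of a finite vertex set $V(T)$ and an asymmetric, complete binary relation $\succ$ on $V(T)$ ($x$ dominates $y$ if $x\succ y$). For $v\in V(T)$ let $N^-_T(v)=\{u\in V(T): u\succ v\}$; for $B\subseteq V(T)$, $T[B]$ is the induced subtournament. The tournament equilibrium set $\tau$ is defined recursively: a nonempty $A\subseteq V(T)$ is $\tau$-retentive if for every $v\in A$ with $N^-_T(v)\neq\emptyset$, $\tau(T[N^-_T(v)])\subseteq A$; $A$ is a minimal $\tau$-retentive set if no $\tau$-retentive set of $T$ is a proper subset of $A$; $\tau(T)$ is the union of all minimal $\tau$-retentive sets of $T$. A tournament $H$ is a $\tau$-retentive tournament if there is a tournament $T$ with a minimal $\tau$-retentive set $R$ such that $T[R]$ is isomorphic to $H$. *)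

(* Defs.v *)
From mathcomp Require Import all_boot.
From mathcomp Require Import boolp.

Set Implicit Arguments.
Unset Strict Implicit.
Unset Printing Implicit Defensive.

Definition is_tournament (V : finType) (e : rel V) : bool :=
  [forall x, forall y, e x y ==> ~~ e y x] &&
  [forall x, forall y, (x != y) ==> (e x y || e y x)].

Record tournament := Tournament {
  vertex :> finType;
  dom : rel vertex;
  domP : is_tournament dom }.

Definition isomorphic (T U : tournament) : Prop :=
  exists2 f : T -> U, bijective f & forall x y, dom (f x) (f y) = dom x y.

Lemma isomorphic_refl (T : tournament) : isomorphic T T.
Proof. by exists id => //; exists id. Qed.

Lemma isomorphic_sym (T U : tournament) : isomorphic T U -> isomorphic U T.
Proof.
move=> [f [g fK gK] fE]; exists g; first by exists f.
by move=> x y; rewrite -fE !gK.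
Qed.

Lemma isomorphic_trans (T U W : tournament) :
  isomorphic T U -> isomorphic U W -> isomorphic T W.
Proof.
move=> [f bf fE] [g bg gE]; exists (g \o f); first exact: bij_comp.
by move=> x y /=; rewrite gE fE.
Qed.

Section Induced.
Variables (T : tournament) (B : {set T}).

Definition induced_dom : rel {x : T | x \in B} := fun x y => dom (val x) (val y).

Fact induced_domP : is_tournament induced_dom.
Proof.
have /andP[/forallP as_ /forallP co] := domP T.
apply/andP; split; apply/forallP=> x; apply/forallP=> y.
  exact: (forallP (as_ (val x)) (val y)).
by rewrite -val_eqE; exact: (forallP (co (val x)) (val y)).
Qed.

Definition induced : tournament := Tournament induced_domP.

End Induced.

Definition inN (T : tournament) (v : T) : {set T} := [set u | dom u v].

(* [t] is the choice map whose retentive sets are considered; it is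
   instantiated with the recursive calls of [tau] below. *)
Definition retentive_for (t : forall U : tournament, {set U})
    (T : tournament) (A : {set T}) : bool :=
  (A != set0) &&
  [forall (v : T | (v \in A) && (inN v != set0)),
     [set val x | x in t (induced (inN v))] \subset A].

(* Recursion on a bound for the number of vertices: the subtournament induced
   by [inN v] has fewer vertices than [T]. See [tauE]. *)
Fixpoint tau_rec (n : nat) (T : tournament) : {set T} :=
  if n is m.+1
  then \bigcup_(A : {set T} | minset (@retentive_for (tau_rec m) T) A) A
  else set0.

Definition tau (T : tournament) : {set T} := tau_rec #|T| T.

Definition retentive (T : tournament) (A : {set T}) : bool :=
  retentive_for tau A.

Lemma card_induced (T : tournament) (B : {set T}) : #|induced B| = #|B|.
Proof. by rewrite /= card_sig; apply: eq_card => x; rewrite !inE. Qed.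

Lemma card_inN (T : tournament) (v : T) : #|inN v| < #|T|.
Proof.
rewrite -cardsT; apply: proper_card; apply/properP; split; first exact: subsetT.
exists v; rewrite ?inE //; have /andP[/forallP/(_ v)/forallP/(_ v) + _] := domP T.
by case: (dom v v).
Qed.

Lemma tau_rec_fuel (n m : nat) (T : tournament) :
  #|T| <= n -> #|T| <= m -> tau_rec n T = tau_rec m T.
Proof.
elim: n m T => [|n IHn] [|m] T //= len lem.
- by apply/setP=> x; move: len; rewrite leqn0 => /eqP/card0_eq/(_ x).
- by apply/setP=> x; move: lem; rewrite leqn0 => /eqP/card0_eq/(_ x).
apply: eq_bigl => A; congr (minset _ A); apply/funext => C.
rewrite /retentive_for; congr (_ && _); apply: eq_forallb => v.
have lt_v := card_inN v.
by rewrite (IHn m) // card_induced -ltnS; exact: leq_trans lt_v _.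
Qed.

Lemma tauE (T : tournament) :
  tau T = \bigcup_(A : {set T} | minset (@retentive T) A) A.
Proof.
rewrite /tau (@tau_rec_fuel _ #|T|.+1) //=.
apply: eq_bigl => A; congr (minset _ A); apply/funext => C.
rewrite /retentive /retentive_for; congr (_ && _); apply: eq_forallb => v.
by rewrite (@tau_rec_fuel #|T| #|induced (inN v)|) // card_induced ltnW ?card_inN.
Qed.

Definition retentive_tournament (H : tournament) : Prop :=
  exists (T : tournament) (R : {set T}),
    minset (@retentive T) R /\ isomorphic (induced R) H.

Definition tournament_on (n : nat) :=
  {D : {set 'I_n * 'I_n} | is_tournament (fun x y => (x, y) \in D)}.

Definition tournament_of (n : nat) (H : tournament_on n) : tournament :=
  Tournament (valP H).

Lemma tournament_of_surj (T : tournament) :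
  exists H : tournament_on #|T|, isomorphic T (tournament_of H).
Proof.
pose D := [set p : 'I_#|T| * 'I_#|T| | dom (enum_val p.1) (enum_val p.2)].
have DP : is_tournament (fun x y => (x, y) \in D).
  have /andP[/forallP as_ /forallP co] := domP T.
  apply/andP; split; apply/forallP=> x; apply/forallP=> y; rewrite !inE /=.
    exact: (forallP (as_ (enum_val x)) (enum_val y)).
  rewrite -(inj_eq enum_val_inj).
  exact: (forallP (co (enum_val x)) (enum_val y)).
exists (exist _ D DP), enum_rank; first exact: enum_rank_bij.
by move=> x y; rewrite /= inE /= !enum_rankK.
Qed.

(* By [tournament_of_surj], every isomorphism class of tournaments with n
   vertices has a representative in [tournament_on n]. *)
Definition beta (n : nat) : nat :=
  #|equivalence_partition
      (fun H K : tournament_on n =>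
         `[< isomorphic (tournament_of H) (tournament_of K) >])
      [set H : tournament_on n | `[< retentive_tournament (tournament_of H) >]]|.

(* Main.v *)
(* In a minimal retentive set R of T, every x in R lies in tau of the
   in-neighbourhood of some v in R, and R is strongly connected for the relation
   "x is in tau of the in-neighbourhood of v".  By induction, tau of a set C,
   when contained in R, has no vertex covered inside the intersection of C and R
   (z covers x if z dominates x and all vertices dominated by x).  Hence in H = T[R] the relation "x is uncovered in
   the in-neighbourhood of v" is strongly connected, and no vertex of H is covered.

   Up to 8 vertices, the tournaments without covered vertices are enumerated by
   splitting them at a vertex of minimal outdegree, none of whose in-neighbours
   dominates all its out-neighbours; for 6 and 7 vertices those with
   the connectedness property satisfy tau(H) = H, so that T = H is a witness.

   For n = 9 and n = 10, either all scores are between 3 and n - 4, or H or its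
   converse has a vertex of outdegree 1 or 2.  The latter are enumerated as above.
   The former are counted up to isomorphism by Burnside's lemma: the number of
   labelled ones is computed from their score sequences, and a tournament fixed by
   a permutation s <> 1 is determined by one arc in each orbit of s on the pairs of
   vertices, where every orbit has size at least 3 except for pairs of fixed points. *)
From Stdlib Require Import BinNat PArith NArith Lia.
From mathcomp Require Import all_boot all_fingroup cyclic boolp.
Require Import Defs.

Set Implicit Arguments.
Unset Strict Implicit.
Unset Printing Implicit Defensive.

(** * Enumeration of adjacency matrices *)

Notation mx := (seq (seq bool)).

Fixpoint bits k : seq (seq bool) :=
  if k is k'.+1 then map (cons true) (bits k') ++ map (cons false) (bits k')
  else [:: [::]].

Fixpoint add_column (r : seq bool) (M : mx) : mx :=
  match r, M with
  | b :: r', row :: M' => (~~ b :: row) :: add_column r' M'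
  | _, _ => [::]
  end.

Definition add_vertex (M : mx) r : mx := (false :: r) :: add_column r M.

Definition entry (M : mx) i j := nth false (nth [::] M i) j.

Definition permute (M : mx) p : mx := [seq [seq entry M i j | j <- p] | i <- p].

(* The functions below run inside the virtual machine, which evaluates both
   arguments of [&&] and [||]: hence the conditionals. *)

Fixpoint countN (r : seq bool) : N :=
  if r is b :: r' then if b then N.succ (countN r') else countN r' else 0%num.

Fixpoint interN (r r' : seq bool) : N :=
  match r, r' with
  | b :: t, b' :: t' => if b && b' then N.succ (interN t t') else interN t t'
  | _, _ => 0%num
  end.

Fixpoint keyN (row cur : seq bool) (rows : seq (N * seq bool)) : N :=
  match cur, rows with
  | b :: cur', (s, r) :: rows' =>
     if b then let k := (3 * s + interN row r)%num in
               (k * k * k + keyN row cur' rows')%num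
     else keyN row cur' rows'
  | _, _ => 0%num
  end.

(* Any isomorphism invariant would do; this one separates the tournaments
   with at most 7 vertices that have to be proved non-isomorphic. *)
Definition invariantN (M : mx) : N :=
  let rows := [seq (countN r, r) | r <- M] in
  foldr (fun r a => let k := keyN r r rows in (k * k + a)%num) 0%num M.

(** Stops when [p] is exhausted: a new vertex is compared only with those already placed. For
    adjacency matrices of tournaments the reversed arcs then agree as well. *)
Fixpoint extends (row : seq bool) (p : seq nat) (row' : seq bool) : bool :=
  match p, row' with
  | j :: p', b :: r' =>
    if (if nth false row j then b else ~~ b) then extends row p' r' else false
  | _, _ => true
  end.

Definition extend_embeddings (M : mx) (ps : seq (seq nat)) row' :=
  [seq rcons p v | p <- ps,
     v <- [seq v <- iota 0 (size M) |
             if v \in p then false else extends (nth [::] M v) p row']].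

(* No property of the search for [p] is needed, since [p] is checked. *)
Definition isomorphic_mx (M M' : mx) : bool :=
  has (fun p => perm_eq p (iota 0 (size M)) && (permute M p == M'))
      (foldl (extend_embeddings M) [:: [::]] M').

Definition up_to_iso (L : seq mx) : seq mx :=
  [seq x.2 | x <- foldr (fun M acc => let i := invariantN M in
     if has (fun x => if N.eqb x.1 i then isomorphic_mx M x.2 else false) acc
     then acc else (i, M) :: acc) [::] L].

Fixpoint tournaments k : seq mx :=
  if k is k'.+1
  then up_to_iso [seq add_vertex M r | M <- tournaments k', r <- bits k']
  else [:: [::]].

Fixpoint row_sub (r r' : seq bool) : bool :=
  match r, r' with
  | b :: t, b' :: t' => if (if b then b' else true) then row_sub t t' else false
  | _, _ => true
  end.

Fixpoint uncovered_mx (M : mx) : bool :=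
  if M is r :: M' then
    if has (fun r' => if row_sub r r' then true else row_sub r' r) M'
    then false else uncovered_mx M'
  else true.

Fixpoint cons_column (c : seq bool) (C : mx) : mx :=
  match c, C with
  | b :: c', r :: C' => (b :: r) :: cons_column c' C'
  | _, _ => [::]
  end.

(** Built column by column, one column for each in-neighbour of the split vertex. A nonzero column
    means that some out-neighbour dominates this in-neighbour. *)
Fixpoint crossings d m : seq mx :=
  if m is m'.+1
  then [seq cons_column c C | c <- filter (has id) (bits d), C <- crossings d m']
  else [:: nseq d [::]].

(** The vertices of [A] are put back in front of [Z] one at a time. Each [behead] drops a diagonal
    entry or a column that [add_vertex] writes anew. *)
Fixpoint glue (A C Z : mx) : mx :=
  match A, C with
  | r :: A', c :: C' => add_vertex (glue (map behead A') C' Z) (behead r ++ c)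
  | _, _ => Z
  end.

(* A vertex of outdegree [d] that is not covered: no in-neighbour of it, whose
   subtournaments are listed in [Zs], dominates all its out-neighbours. *)
Definition splits d m (Zs : seq mx) : seq mx :=
  let x := nseq d true ++ nseq m false in
  [seq add_vertex (glue AZ.1 C AZ.2) x
     | AZ <- [seq (A, Z) | A <- tournaments d, Z <- Zs], C <- crossings d m].

(** * Closed sets of the expansion relations, computed on lists *)

Section Expansion.
Variables (T : eqType) (d : rel T).

Definition uncovered_seq (B : seq T) : seq T :=
  [seq u <- B | ~~ has (fun z =>
     if d z u then all (fun y => d u y ==> d z y) B else false) B].

Definition expansions (s : seq T) :=
  [seq (v, uncovered_seq [seq u <- s | d u v]) | v <- s].

Definition closure (E : seq (T * seq T)) n x :=
  iter n (fun r => undup (flatten [seq e.2 | e <- E & e.1 \in r] ++ r)) [:: x].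

Definition closed_under (E : seq (T * seq T)) (r : seq T) : bool :=
  all (fun e => if e.1 \in r then all (fun u => u \in r) e.2 else true) E.

(** Nonemptiness, properness and closedness of [r] are tested directly, so a positive answer is
    conclusive whatever the number of iterations in [closure]. *)
Definition has_proper_closed (s : seq T) : bool :=
  let E := expansions s in
  has (fun x => let r := closure E (size s) x in
     if (size r < size s) && (x \in r) then closed_under E r else false) s.

(* Succeeds when [tau] is the unique minimal retentive set at each stage. *)
Fixpoint tau_seq k (s : seq T) : option (seq T) :=
  if k is k'.+1 then
    let E := [seq (v, tau_seq k' [seq u <- s | d u v]) | v <- s] in
    if all (fun e => isSome e.2) E then
      let E' := [seq (e.1, odflt [::] e.2) | e <- E] in
      let rs := [seq closure E' (size s) v | v <- s] in
      let S := [seq u <- s | all (fun r : seq T => u \in r) rs] in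
      if (nilp s || ~~ nilp S) && closed_under E' S then Some S else None
    else None
  else if s is [::] then Some [::] else None.

End Expansion.

(** For [1 < n], the minimal outdegree [d] is positive when no vertex is covered, and it is at most
    the average score [(n - 1) / 2]. *)
Definition uncovered_tournaments n : seq mx :=
  up_to_iso (filter uncovered_mx (flatten
    [seq splits d (n.-1 - d) (tournaments (n.-1 - d)) | d <- iota 1 (n.-1)./2])).

Definition strong_mx M := ~~ has_proper_closed (entry M) (iota 0 (size M)).

Definition strong_tournaments n := filter strong_mx (uncovered_tournaments n).

(** * Minimal retentive sets *)

Section Dominance.
Variable T : tournament.
Implicit Types x y : T.

Lemma dom_asym x y : dom x y -> ~~ dom y x.
Proof. by have /andP[/forallP/(_ x)/forallP/(_ y)/implyP] := domP T. Qed.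

Lemma dom_irr x : dom x x = false.
Proof. by apply/negP => xx; move: (dom_asym xx); rewrite xx. Qed.

Lemma domC x y : x != y -> dom y x = ~~ dom x y.
Proof.
have /andP[_ /forallP/(_ x)/forallP/(_ y)/implyP tot] := domP T.
by move=> /tot; case: (boolP (dom x y)) => [/dom_asym/negbTE|_ /=].
Qed.

End Dominance.

Lemma imset_minset (T U : finType) (f : T -> U) (P : pred {set T})
    (Q : pred {set U}) (A : {set T}) :
  bijective f -> (forall B : {set T}, Q (f @: B) = P B) ->
  minset Q (f @: A) = minset P A.
Proof.
move=> [g fK gK] PQ; have inj_f := can_inj fK.
have imK (B : {set U}) : f @: (g @: B) = B.
  by rewrite -imset_comp (eq_imset _ gK) imset_id.
apply/minsetP/minsetP => -[].
  rewrite PQ => PA minA; split=> // B PB sBA.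
  by apply: (imset_inj inj_f); apply: minA; rewrite ?PQ ?imsetS.
move=> PA minA; rewrite PQ; split=> // B QB sBA.
have sBA' : g @: B \subset A.
  by apply/subsetP=> _ /imsetP[y /(subsetP sBA)/imsetP[x xA ->] ->]; rewrite fK.
by rewrite -(minA (g @: B)) ?imK // -PQ imK.
Qed.

Definition tau_in_with (t : forall U : tournament, {set U}) (T : tournament)
  (B : {set T}) : {set T} := [set val x | x in t (induced B)].

Lemma retentive_forP t (T : tournament) (A : {set T}) :
  reflect (A != set0 /\ forall v u, v \in A -> u \in tau_in_with t (inN v) -> u \in A)
          (retentive_for t A).
Proof.
apply: (iffP andP) => -[A0 clA]; split=> //.
  move=> v u vA uv; have /imsetP[x _ ux] := uv.
  move/forallP/(_ v)/implyP: clA; rewrite vA => /(_ _)/subsetP; apply=> //.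
  by apply/set0Pn; exists u; rewrite ux (valP x).
apply/forallP=> v; apply/implyP=> /andP[vA _]; apply/subsetP=> u; exact: clA.
Qed.

(** An isomorphism restricts to isomorphisms between the in-neighbourhoods of [v] and of [f v], to
    which the induction on the fuel applies. Hence [f] carries retentive sets to retentive sets, and
    minimal ones to minimal ones. *)
Lemma tau_rec_iso n (T U : tournament) (f : T -> U) :
  bijective f -> (forall x y, dom (f x) (f y) = dom x y) ->
  tau_rec n U = f @: tau_rec n T.
Proof.
elim: n T U f => [|n IHn] T U f bf fE /=; first by rewrite imset0.
have [g fK gK] := bf; have inj_f := can_inj fK.
have inNE v : inN (f v) = f @: inN v.
  by apply/setP=> y; rewrite inE -[y]gK fE mem_imset // inE.
have recE v : tau_in_with (tau_rec n) (inN (f v)) =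
              f @: tau_in_with (tau_rec n) (inN v).
  have fv (x : induced (inN v)) : f (val x) \in inN (f v).
    by rewrite inNE imset_f ?(valP x).
  have gv (y : induced (inN (f v))) : g (val y) \in inN v.
    by rewrite inE -fE gK; have := valP y; rewrite inE.
  pose h (x : induced (inN v)) : induced (inN (f v)) :=
    @exist _ (fun z => z \in inN (f v)) _ (fv x).
  pose k (y : induced (inN (f v))) : induced (inN v) :=
    @exist _ (fun z => z \in inN v) _ (gv y).
  rewrite /tau_in_with (IHn _ _ h).
  - by rewrite -!imset_comp.
  - by exists k => x; apply: val_inj; rewrite /= ?fK ?gK.
  - by move=> x y; rewrite /= /induced_dom /= fE.
have retE (A : {set T}) :
    retentive_for (tau_rec n) (f @: A) = retentive_for (tau_rec n) A.
  apply/retentive_forP/retentive_forP; rewrite imset_eq0 => -[A0 clA]; split=> //.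
    by move=> v u vA uv; rewrite -(mem_imset _ _ inj_f) (clA (f v)) ?recE ?imset_f.
  by move=> _ u /imsetP[v vA ->]; rewrite recE => /imsetP[w wv ->];
    apply: imset_f; apply: clA wv.
apply/setP=> y; apply/bigcupP/imsetP.
  case=> A minA yA; exists (g y); rewrite ?gK //.
  have AE : A = f @: (g @: A) by rewrite -imset_comp (eq_imset _ gK) imset_id.
  apply/bigcupP; exists (g @: A); last by rewrite imset_f.
  by rewrite -(imset_minset _ bf retE) -AE.
case=> x /bigcupP[A minA xA] ->; exists (f @: A); last exact: imset_f.
by rewrite (imset_minset _ bf retE).
Qed.

Lemma tau_iso (T U : tournament) (f : T -> U) :
  bijective f -> (forall x y, dom (f x) (f y) = dom x y) -> tau U = f @: tau T.
Proof.
move=> bf fE; rewrite /tau (bij_eq_card bf).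
exact: tau_rec_iso.
Qed.

Definition tau_in (T : tournament) (B : {set T}) : {set T} := tau_in_with tau B.

Lemma retentiveP (T : tournament) (A : {set T}) :
  reflect (A != set0 /\ forall v u, v \in A -> u \in tau_in (inN v) -> u \in A)
          (retentive A).
Proof. exact: retentive_forP. Qed.

Lemma tau_neq0 (T : tournament) : 0 < #|T| -> tau T != set0.
Proof.
move=> T0; have ret : retentive [set: T].
  by apply/retentiveP; rewrite -cards_eq0 cardsT -lt0n; split=> // v u; rewrite inE.
have [A minA _] := minset_exists ret.
have /retentiveP[/set0Pn[x xA] _] := minsetp minA.
by apply/set0Pn; exists x; rewrite tauE; apply/bigcupP; exists A.
Qed.

Lemma tau_in_neq0 (T : tournament) (B : {set T}) : B != set0 -> tau_in B != set0.
Proof.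
move=> B0; rewrite imset_eq0; apply: (@tau_neq0 (induced B)).
by rewrite card_induced card_gt0.
Qed.

Section TauIn.
Variable T : tournament.
Implicit Types A B C : {set T}.

Lemma tau_in_sub B : tau_in B \subset B.
Proof. by apply/subsetP=> _ /imsetP[x _ ->]; exact: valP. Qed.

Lemma tau_unique A :
  retentive A -> (forall B, retentive B -> A \subset B) ->
  minset (@retentive T) A /\ tau T = A.
Proof.
move=> retA leA; have minA : minset (@retentive T) A.
  by apply/minsetP; split=> // B /leA sAB sBA; apply/eqP; rewrite eqEsubset sBA.
split=> //; rewrite tauE; apply/eqP; rewrite eqEsubset; apply/andP; split.
  apply/bigcupsP=> B /minsetP[/leA sAB minB].
  by rewrite (minB A).
by apply: (bigcup_sup A).
Qed.

Lemma minset_retentive_closed A (X : {set T}) :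
  minset (@retentive T) A -> X \subset A -> X != set0 ->
  (forall v u, v \in X -> u \in tau_in (inN v) -> u \in X) -> X = A.
Proof. by move=> /minsetP[_ minA] sXA X0 clX; apply: minA => //; apply/retentiveP. Qed.

Lemma tau_closed v u : v \in tau T -> u \in tau_in (inN v) -> u \in tau T.
Proof.
rewrite tauE => /bigcupP[A minA vA] uv; apply/bigcupP; exists A => //.
by have /retentiveP[_ clA] := minsetp minA; apply: clA uv.
Qed.

(** The vertices reached from [A] in one step form a nonempty closed subset of [A], which is all of
    [A] by minimality. *)
Lemma minset_retentive_pred A x :
  minset (@retentive T) A -> x \in A -> inN x != set0 ->
  exists2 v, v \in A & x \in tau_in (inN v).
Proof.
move=> minA xA Nx; have /retentiveP[_ clA] := minsetp minA.
pose X := [set u | [exists v, (v \in A) && (u \in tau_in (inN v))]].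
have XE : X = A.
  apply: minset_retentive_closed minA _ _ _.
  - by apply/subsetP=> u; rewrite inE => /existsP[v /andP[vA]]; exact: clA.
  - have /set0Pn[u ux] := tau_in_neq0 Nx.
    by apply/set0Pn; exists u; rewrite inE; apply/existsP; exists x; rewrite xA.
  - move=> v u; rewrite !inE => /existsP[w /andP[wA vw]] uv.
    by apply/existsP; exists v; rewrite uv (clA w).
by move: xA; rewrite -{1}XE inE => /existsP[v /andP[vA xv]]; exists v.
Qed.

Lemma tau_pred x : x \in tau T -> inN x != set0 ->
  exists2 v, v \in tau T & x \in tau_in (inN v).
Proof.
rewrite tauE => /bigcupP[A minA xA] /(minset_retentive_pred minA xA)[v vA xv].
by exists v => //; apply/bigcupP; exists A.
Qed.

End TauIn.

(** With [val_inN], turns nested in-neighbourhoods into intersections inside the single tournament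
    [T]. *)
Lemma val_tau_in (T : tournament) (C : {set T}) (B : {set induced C}) :
  [set val x | x in tau_in B] = tau_in [set val x | x in B].
Proof.
have fB (x : induced B) : val (val x) \in [set val y | y in B].
  exact: imset_f (valP x).
pose h (x : induced B) : induced [set val y | y in B] :=
  @exist _ (fun z => z \in [set val y | y in B]) _ (fB x).
have inj_h : injective h by move=> x y [] /val_inj/val_inj.
rewrite /tau_in /tau_in_with (@tau_iso _ _ h).
- by rewrite -!imset_comp.
- by apply: inj_card_bij inj_h _; rewrite !card_induced (card_imset _ val_inj).
- by [].
Qed.

Lemma val_inN (T : tournament) (C : {set T}) (v : induced C) :
  [set val x | x in inN v] = C :&: inN (val v).
Proof.
apply/setP=> u; rewrite !inE; apply/imsetP/andP.
  by case=> x; rewrite inE => xv ->; split; [exact: valP|].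
by case=> uC uv; exists (@exist _ (fun z => z \in C) _ uC); rewrite ?inE.
Qed.

Section TauInC.
Variables (T : tournament) (C : {set T}).

Lemma tau_in_closed v u :
  v \in tau_in C -> u \in tau_in (C :&: inN v) -> u \in tau_in C.
Proof.
case/imsetP=> x xt ->; rewrite -val_inN -val_tau_in => /imsetP[y yx ->].
exact: imset_f (tau_closed xt yx).
Qed.

Lemma tau_in_pred x z : x \in tau_in C -> z \in C -> dom z x ->
  exists2 v, v \in tau_in C & x \in tau_in (C :&: inN v).
Proof.
case/imsetP=> {}x xt -> zC zx; case: (tau_pred xt).
  by apply/set0Pn; exists (@exist _ (fun z => z \in C) _ zC); rewrite inE.
move=> v vt xv; exists (val v); first exact: imset_f.
by rewrite -val_inN -val_tau_in imset_f.
Qed.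

End TauInC.

(** Take a predecessor [v] of [x], that is, [v] in [tau_in C] with [x] in [tau_in (C :&: inN v)];
    then [x] dominates [v]. If [v] dominates [z], take [y = v]. Otherwise [z] dominates [v], so [z]
    also lies in the smaller set [C :&: inN v], to which induction applies: its tau stays in [R] by
    [tau_in_closed]. *)
Lemma tau_in_uncovered (T : tournament) (R C : {set T}) (x z : T) :
  tau_in C \subset R -> x \in tau_in C -> z \in C :&: R -> dom z x ->
  exists2 y, y \in C :&: R & dom x y && dom y z.
Proof.
move En: #|C| => n; elim/ltn_ind: n C En x z => n IHn C Cn x z sCR xC zCR zx.
have /setIP[zC zR] := zCR.
have [v vt xv] := tau_in_pred xC zC zx.
have vCR : v \in C :&: R.
  by rewrite inE (subsetP sCR) // (subsetP (tau_in_sub C)).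
have vx : dom x v by have := subsetP (tau_in_sub _) _ xv; rewrite !inE => /andP[].
have [eqzv|neqzv] := eqVneq z v.
  by move: (dom_asym zx); rewrite eqzv vx.
have [vz|nvz] := boolP (dom v z); first by exists v; rewrite ?vx.
have zv : dom z v by rewrite (domC (x := v)) 1?eq_sym.
have lt_n : #|C :&: inN v| < n.
  rewrite -Cn; apply: proper_card; apply/properP; split; first exact: subsetIl.
  by exists v; rewrite ?inE ?dom_irr ?andbF //; case/setIP: vCR.
have [||||y] := IHn _ lt_n _ erefl x z.
- apply: subset_trans sCR; apply/subsetP=> w; exact: tau_in_closed.
- exact: xv.
- by rewrite !inE zC zv.
- exact: zx.
by rewrite !inE => /andP[/andP[yC _] yR] yxz; exists y; rewrite ?inE ?yC.
Qed.

Section RetentiveTournament.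
Variable H : tournament.
Hypothesis retH : retentive_tournament H.

Definition uncovered_in (B : {set H}) (u : H) : Prop :=
  forall z, z \in B -> dom z u -> exists2 y, y \in B & dom u y && dom y z.

(** Transport [X] to a set [Y] inside the minimal retentive set [R]. Were [Y] closed, minimality
    would give [Y = R]; so some [u] outside [Y] lies in the tau of the in-neighbourhood of some [v]
    in [Y]. That tau is contained in [R], and [tau_in_uncovered] applies. *)
Lemma retentive_tournament_expand (X : {set H}) : X != set0 -> X != setT ->
  exists v u, [/\ v \in X, u \notin X, dom u v & uncovered_in (inN v) u].
Proof.
have [T [R [minR [f [g fK gK] fE]]]] := retH.
move=> X0 XT; pose Y := [set val (g x) | x in X].
have inj_vg : injective (fun x => val (g x)).
  by move=> x y /val_inj /(can_inj gK).
have YR : Y \subset R by apply/subsetP=> _ /imsetP[x _ ->]; exact: valP.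
have gE x y : dom (val (g x)) (val (g y)) = dom x y.
  by rewrite -[x in RHS]gK -[y in RHS]gK fE.
have [v [u [vY uv uY]]] : exists v u, [/\ v \in Y, u \in tau_in (inN v) & u \notin Y].
  apply/not_existsP => noex.
  have YE : Y = R.
    apply: (minset_retentive_closed minR) => //; first by rewrite imset_eq0.
    move=> v u vY uv; apply: contra_notT (noex v) => uY; by exists u.
  case/eqP: XT; apply/setP=> x; rewrite inE -(mem_imset _ _ inj_vg) -/Y YE; exact: valP.
have [a aX va] := imsetP vY.
have uR : u \in R.
  by have /retentiveP[_ clR] := minsetp minR; apply: clR uv; apply: (subsetP YR).
pose b := f (@exist _ (fun z => z \in R) _ uR).
have ub : u = val (g b) by rewrite fK.
exists a, b; split=> //.
- by apply: contra uY => bX; rewrite ub; apply/imsetP; exists b.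
- by rewrite -gE -va -ub; have := subsetP (tau_in_sub _) _ uv; rewrite inE.
move=> z za zb.
have [|||y] := @tau_in_uncovered T R (inN v) u (val (g z)) _ uv.
- have /retentiveP[_ clR] := minsetp minR.
  by apply/subsetP => w; apply: clR; exact: (subsetP YR).
- by rewrite !inE va gE (valP (g z)) andbT; rewrite inE in za.
- by rewrite ub gE.
rewrite inE => /andP[yv yR] /andP[uy yz].
have [c yE] : exists c, y = val (g c).
  by exists (f (@exist _ (fun z => z \in R) _ yR)); rewrite fK.
exists c; first by move: yv; rewrite !inE va yE gE.
by move: uy yz; rewrite yE ub !gE => -> ->.
Qed.

(** Expanding the complement of [u] gives a vertex [v] dominated by [u] such that [u] is uncovered
    in [inN v]. If [z] dominates [v], this provides [y]; if not, [y = v] works. *)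
Lemma retentive_tournament_uncovered (u z : H) :
  dom z u -> exists2 y, dom u y & dom y z.
Proof.
move=> zu; have neq : z != u by apply: contraTneq zu => ->; rewrite dom_irr.
have [||v [w]] := @retentive_tournament_expand [set~ u].
- by apply/set0Pn; exists z; rewrite !inE.
- by apply/eqP => /setP/(_ u); rewrite !inE eqxx.
rewrite !inE negbK => -[vu /eqP-> uv unc].
have [zv|nzv] := boolP (dom z v).
  by have [||y _ /andP[]] := unc z; rewrite ?inE //; exists y.
exists v => //; rewrite (domC (x := z)) //.
by apply: contraNneq nzv => zv; move: zu; rewrite zv => /dom_asym; rewrite uv.
Qed.

End RetentiveTournament.

(** * Adjacency matrices of enumerated tournaments *)

Section Adjacency.
Variables (T : eqType) (d : rel T).
Hypothesis d_irr : forall x, d x x = false.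
Hypothesis dC : forall x y, x != y -> d y x = ~~ d x y.
Implicit Types (s : seq T) (M : mx) (L : seq mx).

Definition adj s : mx := [seq [seq d x y | y <- s] | x <- s].
Definition realized L s := exists2 s', perm_eq s' s & adj s' \in L.

Lemma entry_adj x0 s i j : i < size s -> j < size s ->
  entry (adj s) i j = d (nth x0 s i) (nth x0 s j).
Proof. by move=> lti ltj; rewrite /entry (nth_map x0) // (nth_map x0). Qed.

Lemma permute_adj x0 s p : all (gtn (size s)) p ->
  permute (adj s) p = adj [seq nth x0 s i | i <- p].
Proof.
move=> /allP lt_p; rewrite /permute {2}/adj -map_comp.
apply/eq_in_map => i ip; rewrite /comp -map_comp; apply/eq_in_map => j jp /=.
by apply: entry_adj; exact: lt_p.
Qed.

Lemma adj_cons x s : x \notin s -> adj (x :: s) = add_vertex (adj s) [seq d x y | y <- s].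
Proof.
move=> xs; rewrite /adj /add_vertex /= d_irr; congr (_ :: _).
(* The induction runs over the rows [t] only, while the columns remain those of all of [s]. *)
set f := d x; suff: forall t, {subset t <= s} ->
   [seq [seq d y z | z <- x :: s] | y <- t] =
   add_column [seq f y | y <- t] [seq [seq d y z | z <- s] | y <- t].
  by apply.
elim=> //= y t IHt sts; rewrite IHt; last first.
  by move=> z zt; apply: sts; rewrite inE zt orbT.
congr ((_ :: _) :: _); apply: dC; apply: contraNneq xs => ->.
by apply: sts; rewrite mem_head.
Qed.

Lemma perm_nth_iota x0 s p : perm_eq p (iota 0 (size s)) ->
  perm_eq [seq nth x0 s i | i <- p] s.
Proof. by move=> /(perm_map (nth x0 s)); rewrite map_nth_iota0 // take_size. Qed.

Lemma isomorphic_mx_adj s M : isomorphic_mx (adj s) M -> exists2 s', perm_eq s' s & adj s' = M.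
Proof.
case/hasP=> p _ /andP[]; rewrite size_map => pP /eqP <-.
case: s pP => [|x0 s] pP; first by exists [::]; rewrite ?(perm_nilP pP).
exists [seq nth x0 (x0 :: s) i | i <- p]; first exact: perm_nth_iota.
rewrite (permute_adj x0) //; apply/allP=> i; rewrite (perm_mem pP) mem_iota.
by case/andP.
Qed.

(** A matrix is discarded only when [isomorphic_mx] has found it isomorphic to one that is kept,
    whatever the invariant does. Nothing is claimed about the kept matrices being pairwise
    non-isomorphic. *)
Lemma realized_up_to_iso L s : realized L s -> realized (up_to_iso L) s.
Proof.
case=> s' pss'; suff: adj s' \in L -> realized (up_to_iso L) s'.
  by move=> H /H[s'' p ?]; exists s'' => //; apply: perm_trans p pss'.
rewrite /up_to_iso; elim: L => //= M L IHL; set acc := foldr _ _ L in IHL *.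
rewrite inE => /predU1P[<-|/IHL]; last first.
  by case: ifP => // _ [t pt tL]; exists t; rewrite // inE tL orbT.
case: ifP => [/hasP[[i M'] xacc /=]|_]; last by exists s'; rewrite ?mem_head.
case: ifP => // _ /isomorphic_mx_adj[t pt tM]; exists t => //.
by rewrite tM; apply/mapP; exists (i, M').
Qed.

Lemma mem_bits r : r \in bits (size r).
Proof.
elim: r => //= b r IHr; rewrite mem_cat.
by case: b; rewrite map_f ?orbT.
Qed.

Lemma realized_tournaments s : uniq s -> realized (tournaments (size s)) s.
Proof.
elim: s => [_|x s IHs /= /andP[xs us]]; first by exists [::].
have [s' ps' Ms'] := IHs us; apply: realized_up_to_iso; exists (x :: s'); rewrite ?perm_cons //.
rewrite adj_cons ?(perm_mem ps') //; apply/allpairsP.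
exists (adj s', [seq d x y | y <- s']); split=> //=.
by rewrite -(perm_size ps') -(size_map (d x)) mem_bits.
Qed.

Lemma adj_glue os zs : uniq (os ++ zs) ->
  adj (os ++ zs) = glue (adj os) [seq [seq d o z | z <- zs] | o <- os] (adj zs).
Proof.
elim: os => //= o os IHos /andP[o_notin uos].
rewrite adj_cons // IHos // /= -map_comp; congr (add_vertex (glue _ _ _) _).
by rewrite map_cat.
Qed.

Lemma mem_crossings os zs :
  (forall z, z \in zs -> has (d^~ z) os) ->
  [seq [seq d o z | z <- zs] | o <- os] \in crossings (size os) (size zs).
Proof.
elim: zs => [_|z zs IHzs dom_z] /=.
  by rewrite inE; elim: os => //= o os /eqP[->].
have zipE (os' : seq T) : [seq [seq d o z' | z' <- z :: zs] | o <- os'] =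
    cons_column [seq d o z | o <- os'] [seq [seq d o z' | z' <- zs] | o <- os'].
  by elim: os' => //= o os' ->.
apply/allpairsP; exists ([seq d o z | o <- os], [seq [seq d o z' | z' <- zs] | o <- os]).
split; [|by apply: IHzs => z' zz'; apply: dom_z; rewrite inE zz' orbT|exact: zipE].
rewrite mem_filter has_map dom_z ?mem_head //=.
by have := mem_bits [seq d o z | o <- os]; rewrite size_map.
Qed.

Lemma realized_splits Zs s x os zs :
  uniq s -> perm_eq (x :: os ++ zs) s -> realized Zs zs ->
  all (d x) os -> all (fun z => ~~ d x z) zs ->
  (forall z, z \in zs -> has (d^~ z) os) ->
  realized (splits (size os) (size zs) Zs) s.
Proof.
move=> us ps [zs' pzs Zzs'] /allP xos /allP xzs dom_z.
have := us; rewrite -(perm_uniq ps) /= => /andP[_].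
rewrite cat_uniq => /and3P[uos _ _].
have [os' pos Oos'] := realized_tournaments uos.
have ps' : perm_eq (x :: os' ++ zs') s.
  by apply: perm_trans ps; rewrite perm_cons perm_cat.
have := us; rewrite -(perm_uniq ps') /= => /andP[x_notin u'].
exists (x :: os' ++ zs') => //; rewrite adj_cons // adj_glue //.
apply/allpairsP; exists (adj os', adj zs', [seq [seq d o z | z <- zs'] | o <- os']).
split=> /=.
- by apply/allpairsP; exists (adj os', adj zs').
- rewrite -(perm_size pos) -(perm_size pzs); apply: mem_crossings => z.
  by rewrite (perm_mem pzs) (perm_has _ pos); exact: dom_z.
rewrite map_cat -(perm_size pos) -(perm_size pzs); congr (add_vertex _ (_ ++ _)).
  have : {in os', forall o, d x o} by move=> o; rewrite (perm_mem pos); exact: xos.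
  elim: (os') => //= o t IHt xt; rewrite IHt ?xt ?mem_head // => y yt.
  by apply: xt; rewrite inE yt orbT.
have : {in zs', forall z, ~~ d x z} by move=> z; rewrite (perm_mem pzs); exact: xzs.
elim: (zs') => //= o t IHt xt; rewrite IHt ?(negbTE (xt _ (mem_head _ _))) // => y yt.
by apply: xt; rewrite inE yt orbT.
Qed.

Definition uncovered s := {in s &, forall u z, d z u -> exists2 y, y \in s & d u y && d y z}.

Lemma row_subP s (u z : T) : reflect {in s, forall y, d u y -> d z y}
  (row_sub [seq d u y | y <- s] [seq d z y | y <- s]).
Proof.
apply: (iffP idP).
  elim: s => //= x s IHs H y; rewrite inE => /predU1P[->|]; move: H; case: (d u x) => //.
  - by case: (d z x).
  - by case: (d z x) => // /IHs; apply.
  - by move=> /IHs; apply.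
elim: s => //= x s IHs H.
have H' : row_sub [seq d u y | y <- s] [seq d z y | y <- s].
  by apply: IHs => y ys; apply: H; rewrite inE ys orbT.
by case: ifP => //; case: ifP => // ux; rewrite H ?mem_head.
Qed.

(** Inclusion of rows amounts to covering: if [z] dominates all that [u] dominates, then [u] does
    not dominate [z], since [z] would dominate itself; so [z] dominates [u] when they are
    distinct. *)
Lemma uncovered_mxP s : uniq s -> uncovered s -> uncovered_mx (adj s).
Proof.
move=> us unc.
have nosub : {in s &, forall u z, u != z ->
    ~~ row_sub [seq d u y | y <- s] [seq d z y | y <- s]}.
  move=> u z us' zs neq; apply/negP => /row_subP sub.
  have nuz : ~~ d u z by apply: contraFN (d_irr z); exact: sub.
  have [|y ys /andP[uy yz]] := unc u z us' zs; first by rewrite dC.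
  have zy := sub y ys uy; move: yz; rewrite dC ?zy //.
  by apply: contraTneq zy => ->; rewrite d_irr.
rewrite /adj; set row := fun x => [seq d x y | y <- s].
suff: forall t, uniq t -> {subset t <= s} -> uncovered_mx [seq row x | x <- t] by apply.
elim=> //= u t IHt /andP[ut ut'] sts.
have us' : u \in s by apply: sts; rewrite mem_head.
have sts' : {subset t <= s} by move=> z zt; apply: sts; rewrite inE zt orbT.
rewrite IHt //; case: ifP => // /hasP[_ /mapP[z zt ->]].
have neq : u != z by apply: contraNneq ut => ->.
have := nosub _ _ us' (sts' _ zt) neq; have := nosub _ _ (sts' _ zt) us'.
by rewrite eq_sym => /(_ neq); rewrite -/(row u) -/(row z) => /negbTE-> /negbTE->.
Qed.

Definition outdeg s x := count (d x) s.

Lemma realized_splits_at Zs s x : uniq s -> x \in s ->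
  {in s, forall z, d z x -> exists2 y, y \in s & d x y && d y z} ->
  (forall zs, uniq zs -> size zs = (size s).-1 - outdeg s x -> realized Zs zs) ->
  realized (splits (outdeg s x) ((size s).-1 - outdeg s x) Zs) s.
Proof.
move=> us xs unc ZsP; pose os := filter (d x) s; pose zs := filter (predC (d x)) (rem x s).
have ps : perm_eq (x :: os ++ zs) s.
  rewrite perm_sym (permPl (perm_to_rem xs)) perm_cons perm_sym.
  (* By irreflexivity [x] is not among its own out-neighbours, so removing it first changes
     nothing. *)
  have -> : os = filter (d x) (rem x s).
    rewrite /os rem_filter // -filter_predI; apply: eq_filter => y /=.
    by case: eqVneq => [->|]; rewrite ?d_irr ?andbT.
  by rewrite perm_filterC.
have szos : size os = outdeg s x by rewrite size_filter.
have szzs : size zs = (size s).-1 - outdeg s x.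
  by rewrite -(perm_size ps) /= size_cat szos addKn.
rewrite -szzs -szos; apply: (realized_splits (x := x)) => //.
- by apply: ZsP => //; rewrite filter_uniq // rem_uniq.
- by rewrite all_filter; apply/allP=> y _ /=; exact: implybb.
- by rewrite all_filter; apply/allP=> y _ /=; exact: implybb.
move=> z; rewrite mem_filter /= mem_rem_uniq // !inE => /and3P[nxz neq zs'].
have [|y ys /andP[xy yz]] := unc z zs'; first by rewrite dC // eq_sym.
by apply/hasP; exists y; rewrite // mem_filter xy.
Qed.

Lemma sum_outdeg s : uniq s -> \sum_(x <- s) outdeg s x = 'C(size s, 2).
Proof.
elim: s => [|x s IHs /= /andP[xs us]]; first by rewrite big_nil.
have inE' : \sum_(y <- s) d y x = count (predC (d x)) s.
  rewrite -sum1_count [RHS]big_mkcond; apply: eq_big_seq => y ys /=.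
  by rewrite dC; [case: (d x y)|apply: contraNneq xs => ->].
rewrite big_cons /outdeg /= d_irr add0n big_split /= inE' IHs // addnA.
by rewrite count_predC binS bin1 addnC.
Qed.

Lemma outdeg_min s : s != [::] ->
  exists2 x, x \in s & {in s, forall y, outdeg s x <= outdeg s y}.
Proof.
case: s => // x0 s' _; set s := x0 :: s'.
have exP : exists n, has (fun x => outdeg s x == n) s.
  by exists (outdeg s x0); rewrite /= eqxx.
case: (ex_minnP exP) => m /hasP[x xs /eqP<-] minx; exists x => // y ys.
by apply: minx; apply/hasP; exists y.
Qed.

Lemma outdeg_gt0 s x : 1 < size s -> uniq s -> x \in s -> uncovered s -> 0 < outdeg s x.
Proof.
move=> s1 us xs unc; rewrite -has_count.
have [z zs neq] : exists2 z, z \in s & z != x.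
  case: s s1 us xs {unc} => [|a [|b s]] //= _ /andP[]; rewrite !inE negb_or => /andP[ab _] _ _.
  case: (eqVneq a x) ab => [->|ax _]; last by exists a; rewrite ?inE ?eqxx.
  by rewrite eq_sym; exists b; rewrite ?inE ?eqxx ?orbT.
apply/hasP; have [xz|] := boolP (d x z); first by exists z.
by rewrite -dC 1?eq_sym // => /(unc _ _ xs zs)[y ys /andP[xy _]]; exists y.
Qed.

Lemma realized_filter_uncovered L s : uniq s -> uncovered s ->
  realized L s -> realized (filter uncovered_mx L) s.
Proof.
move=> us unc [s' ps' Ls']; exists s' => //; rewrite mem_filter Ls' andbT.
apply: uncovered_mxP; first by rewrite (perm_uniq ps').
move=> u z; rewrite !(perm_mem ps') => us' zs /(unc _ _ us' zs)[y ys yP].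
by exists y; rewrite ?(perm_mem ps').
Qed.

Lemma realized_sub L L' s : {subset L <= L'} -> realized L s -> realized L' s.
Proof. by move=> sub [s' ps' /sub]; exists s'. Qed.

Lemma realized_uncovered s : uniq s -> 1 < size s -> uncovered s ->
  realized (uncovered_tournaments (size s)) s.
Proof.
move=> us s1 unc; apply/realized_up_to_iso/realized_filter_uncovered => //.
have [|x xs minx] := @outdeg_min s; first by case: (s) s1.
have dx0 := outdeg_gt0 s1 us xs unc.
have dxn : outdeg s x <= (size s).-1./2.
  have: size s * outdeg s x <= 'C(size s, 2).
    rewrite -(sum_outdeg us) -sum1_size big_distrl /= big_seq [leqRHS]big_seq.
    by apply: leq_sum => y ys; rewrite mul1n minx.
  rewrite bin2 -divn2 leq_divRL // -mulnA leq_pmul2l; last exact: ltnW.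
  by move=> H; rewrite geq_half_double -muln2.
apply: realized_sub (realized_splits_at (x := x)
  (Zs := tournaments ((size s).-1 - outdeg s x)) us xs _ _).
- move=> M LM; apply/flattenP; exists (splits (outdeg s x) ((size s).-1 - outdeg s x)
     (tournaments ((size s).-1 - outdeg s x))) => //.
  by apply/mapP; exists (outdeg s x); rewrite // mem_iota dx0.
- by move=> z zs; apply: unc.
- by move=> zs uzs <-; exact: realized_tournaments.
Qed.

End Adjacency.

Lemma adj_map (T U : eqType) (d : rel T) (e : rel U) (f : T -> U) (s : seq T) :
  (forall x y, e (f x) (f y) = d x y) -> adj e (map f s) = adj d s.
Proof.
move=> fE; rewrite /adj -map_comp; apply: eq_map => x /=.
by rewrite -map_comp; apply: eq_map => y /=.
Qed.

Lemma adj_inj (T U : eqType) (d : rel T) (e : rel U) (s : seq T) (t : seq U) :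
  adj d s = adj e t -> forall x0 y0 i j, i < size s -> j < size s ->
  d (nth x0 s i) (nth x0 s j) = e (nth y0 t i) (nth y0 t j).
Proof.
move=> st x0 y0 i j lti ltj; rewrite -!entry_adj // ?st //.
by have /(congr1 size) := st; rewrite !size_map => <-.
by have /(congr1 size) := st; rewrite !size_map => <-.
Qed.

Lemma perm_enum_nth (T : finType) (s : seq T) x0 : perm_eq s (enum T) ->
  exists2 g : T -> 'I_#|T|, cancel g (fun i => nth x0 s i) &
    cancel (fun i : 'I_#|T| => nth x0 s i) g.
Proof.
move=> ps; have us : uniq s by rewrite (perm_uniq ps) enum_uniq.
have szs : size s = #|T| by rewrite (perm_size ps) -cardE.
have lt x : index x s < #|T| by rewrite -szs index_mem (perm_mem ps) mem_enum.
exists (fun x => Ordinal (lt x)).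
  by move=> x /=; rewrite nth_index // (perm_mem ps) mem_enum.
by move=> i; apply: val_inj; rewrite /= index_uniq ?szs.
Qed.

(* [c = true] selects the converse tournament. *)
Definition orient (c : bool) (T : tournament) : rel T :=
  fun x y => if c then dom y x else dom x y.

Lemma orient_irr c (T : tournament) (x : T) : orient c x x = false.
Proof. by rewrite /orient dom_irr if_same. Qed.

Lemma orientC c (T : tournament) (x y : T) : x != y -> orient c y x = ~~ orient c x y.
Proof. by rewrite /orient; case: c => neq; rewrite (domC neq) ?negbK. Qed.

Lemma adj_isomorphic c (T U : tournament) (s : seq T) (t : seq U) :
  perm_eq s (enum T) -> perm_eq t (enum U) ->
  adj (@orient c T) s = adj (@orient c U) t -> isomorphic T U.
Proof.
move=> ps pt st.
have szst : size s = size t by have /(congr1 size) := st; rewrite !size_map.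
have cTU : #|T| = #|U| by rewrite !cardE -(perm_size ps) -(perm_size pt).
(* An empty vertex set offers no default element for [nth]; the isomorphism is then the empty
   map. *)
have [x0|T0] := pickP T; last first.
  exists (fun x => False_rect U (Bool.diff_true_false (T0 x))).
    by apply: inj_card_bij => [x|]; [have := T0 x | rewrite -cTU].
  by move=> x; have := T0 x.
have [y0 _|] := pickP U; last first.
  by move/eq_card0; rewrite -cTU => /card0_eq/(_ x0).
have [g gK _] := perm_enum_nth x0 ps.
exists (fun x => nth y0 t (g x)).
  apply: inj_card_bij; last by rewrite cTU.
  move=> x y /eqP; rewrite nth_uniq ?(perm_uniq pt) ?enum_uniq //
    -?szst ?(perm_size ps) -?cardE //.
  by move=> /eqP/val_inj/(can_inj gK).
have H x y : orient c (nth y0 t (g x)) (nth y0 t (g y)) = orient c x y.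
  have := adj_inj st x0 y0 (i := g x) (j := g y).
  by rewrite !gK !(perm_size ps) -!cardE => /(_ (ltn_ord _) (ltn_ord _)) ->.
by move=> x y; move: (H x y) (H y x); rewrite /orient; case: c {st H}.
Qed.

Lemma isomorphic_adj c (T U : tournament) (s : seq T) : perm_eq s (enum T) ->
  isomorphic T U ->
  exists2 t : seq U, perm_eq t (enum U) & adj (@orient c U) t = adj (@orient c T) s.
Proof.
move=> ps [f [g fK gK] fE]; exists (map f s); last first.
  by apply: adj_map => x y; rewrite /orient !fE.
apply: uniq_perm; rewrite ?enum_uniq ?map_inj_uniq ?(perm_uniq ps) ?enum_uniq //.
  exact: can_inj fK.
move=> y; rewrite mem_enum -[y]gK mem_map ?(perm_mem ps) ?mem_enum //.
exact: can_inj fK.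
Qed.

(** * Isomorphism classes *)

Section Classes.
Variable n : nat.
Implicit Types (H K : tournament_on n) (A : {set tournament_on n}).

Definition cls H :=
  [set K : tournament_on n | `[< isomorphic (tournament_of H) (tournament_of K) >]].

Lemma mem_cls H K : (K \in cls H) = `[< isomorphic (tournament_of H) (tournament_of K) >].
Proof. by rewrite inE. Qed.

Definition retentive_on :=
  [set H : tournament_on n | `[< retentive_tournament (tournament_of H) >]].

(** Being a retentive tournament is invariant under isomorphism, so classes may be taken among all
    tournaments instead of the retentive ones. *)
Lemma betaE : beta n = #|cls @: retentive_on|.
Proof.
rewrite /beta /equivalence_partition; congr #|pred_of_set _|.
apply: eq_in_imset => H; rewrite inE => /asboolP[T [R [minR RH]]].
apply/setP=> K; rewrite !inE; apply: andb_idl => /asboolP HK.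
by apply/asboolP; exists T, R; split=> //; apply: isomorphic_trans HK.
Qed.

Lemma card_cls_sub A (B : {set tournament_on n}) : A \subset B -> #|cls @: A| <= #|cls @: B|.
Proof. by move=> sAB; apply/subset_leq_card/imsetS. Qed.

Lemma card_clsU A (B : {set tournament_on n}) : #|cls @: (A :|: B)| <= #|cls @: A| + #|cls @: B|.
Proof. by rewrite imsetU cardsU leq_subr. Qed.

(** A matrix determines the class [g M] of the tournaments that it represents for some ordering of
    the vertices, and every class of a member of [A] is [g M] for some [M] in [L]. *)
Lemma card_cls_le c A (L : seq mx) :
  {in A, forall H, realized (@orient c (tournament_of H)) L (enum 'I_n)} ->
  #|cls @: A| <= size L.
Proof.
move=> AL.
pose g M := [set K : tournament_on n | `[< exists2 s, perm_eq s (enum 'I_n) &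
  adj (@orient c (tournament_of K)) s = M >]].
rewrite cardE -(size_map g); apply: uniq_leq_size; first exact: enum_uniq.
move=> C; rewrite mem_enum => /imsetP[H /AL[s ps sL] ->].
apply/mapP; exists (adj (@orient c (tournament_of H)) s) => //.
apply/setP=> K; rewrite !inE; apply: asbool_equiv_eq; split.
  by move=> /(isomorphic_adj c ps).
case=> t pt tE.
exact: (@adj_isomorphic c (tournament_of H) (tournament_of K) s t ps pt (esym tE)).
Qed.

End Classes.
Arguments cls {n} H.

(** * Labelled tournaments by scores *)

Fixpoint insert_sorted (x : nat) s :=
  if s is y :: s' then if x <= y then x :: s else y :: insert_sorted x s'
  else [:: x].

Definition sort_scores := foldr insert_sorted [::].

(* Score sequences with multiplicities. *)
Notation states_list := (seq (seq nat * N)).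

Fixpoint add_state (t : seq nat) (c : N) (L : states_list) : states_list :=
  if L is (t', c') :: L'
  then if t == t' then (t', N.add c c') :: L' else (t', c') :: add_state t c L'
  else [:: (t, c)].

(* A new vertex plays against vertices with scores [s]; its score comes first. *)
Fixpoint play (s : seq nat) : states_list :=
  if s is a :: s' then
    foldr (fun x acc => if x.1 is w :: t
      then add_state (w.+1 :: a :: t) x.2
             (add_state (w :: insert_sorted a.+1 t) x.2 acc)
      else acc) [::] (play s')
  else [:: ([:: 0], 1%num)].

Definition wsum (g : seq nat -> nat) (L : states_list) : nat :=
  \sum_(x <- L) nat_of_bin x.2 * g x.1.

Lemma nat_of_binE b : nat_of_bin b = N.to_nat b.
Proof.
case: b => // p; rewrite /= -[RHS]/(Pos.to_nat p).
elim: p => [p IHp|p IHp|] //=.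
  by rewrite Pos2Nat.inj_xI NatTrec.doubleE -muln2 mulnC IHp.
by rewrite Pos2Nat.inj_xO NatTrec.doubleE -muln2 mulnC IHp.
Qed.

Lemma nat_of_addN a b : nat_of_bin (N.add a b) = nat_of_bin a + nat_of_bin b.
Proof. by rewrite !nat_of_binE N2Nat.inj_add. Qed.

Lemma nat_of_mulN a b : nat_of_bin (N.mul a b) = nat_of_bin a * nat_of_bin b.
Proof. by rewrite !nat_of_binE N2Nat.inj_mul. Qed.

Lemma perm_cons2C (T : eqType) (x y : T) s : perm_eq [:: x, y & s] [:: y, x & s].
Proof. by apply/seq.permP=> a /=; rewrite addnCA. Qed.

Lemma perm_insert_sorted x s : perm_eq (insert_sorted x s) (x :: s).
Proof.
elim: s => //= y s IHs; case: ifP => // _.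
by rewrite perm_sym; apply: perm_trans (perm_cons2C x y s) _; rewrite perm_cons perm_sym.
Qed.

Lemma perm_sort_scores s : perm_eq (sort_scores s) s.
Proof. by elim: s => //= x s IHs; rewrite (permPl (perm_insert_sorted _ _)) perm_cons. Qed.

Lemma wsum_add_state g t c L : wsum g (add_state t c L) = nat_of_bin c * g t + wsum g L.
Proof.
elim: L => [|[t' c'] L IHL] /=; first by rewrite /wsum big_seq1 big_nil addn0.
case: ifP => [/eqP->|_]; rewrite /wsum !big_cons /=.
  by rewrite nat_of_addN mulnDl addnA.
by rewrite -/(wsum _ _) IHL addnCA.
Qed.

Fixpoint lose (s : seq nat) (r : seq bool) : seq nat :=
  match s, r with a :: s', b :: r' => (a + ~~ b) :: lose s' r' | _, _ => [::] end.

Definition sum_outcomes s (G : nat -> seq nat -> nat) :=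
  \sum_(r <- bits (size s)) G (count id r) (lose s r).

Lemma sum_outcomes_nil G : sum_outcomes [::] G = G 0 [::].
Proof. by rewrite /sum_outcomes big_seq1. Qed.

Lemma sum_outcomes_cons a s G :
  sum_outcomes (a :: s) G = sum_outcomes s (fun w t => G w.+1 (a :: t) + G w (a.+1 :: t)).
Proof.
rewrite /sum_outcomes /= big_cat /= !big_map -big_split /=.
by apply: eq_bigr => r _; rewrite addn0 addn1 add1n.
Qed.

Lemma eq_sum_outcomes s G G' : (forall w t, G w t = G' w t) ->
  sum_outcomes s G = sum_outcomes s G'.
Proof. by move=> GG'; apply: eq_bigr. Qed.

Definition symmetric_in2 (G : nat -> seq nat -> nat) :=
  forall w t t', perm_eq t t' -> G w t = G w t'.

Lemma symmetric_step G a : symmetric_in2 G ->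
  symmetric_in2 (fun w t => G w.+1 (a :: t) + G w (a.+1 :: t)).
Proof. by move=> sG w t t' tt'; congr (_ + _); apply: sG; rewrite perm_cons. Qed.

(** It suffices to move one entry to the front, past one neighbour at a time; each exchange permutes
    the outcomes of two games, and symmetry of [G] absorbs the new order of scores. *)
Lemma perm_sum_outcomes s t G : symmetric_in2 G -> perm_eq s t ->
  sum_outcomes s G = sum_outcomes t G.
Proof.
have catC a t1 t2 : forall G, symmetric_in2 G ->
    sum_outcomes (t1 ++ a :: t2) G = sum_outcomes (a :: t1 ++ t2) G.
  elim: t1 => // b t1 IH {}G sG /=; rewrite sum_outcomes_cons IH; last exact: symmetric_step.
  rewrite !sum_outcomes_cons; apply: eq_sum_outcomes => w u.
  rewrite !(sG _ _ _ (perm_cons2C b _ u)) !(sG _ _ _ (perm_cons2C b.+1 _ u)).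
  by rewrite addnACA.
elim: s t G => [|a s IHs] t G sG; first by rewrite perm_sym => /perm_nilP->.
move=> st; have at_ : a \in t by rewrite -(perm_mem st) mem_head.
case/splitPr: at_ st => t1 t2 st; rewrite catC // !sum_outcomes_cons; apply: IHs.
  exact: symmetric_step.
by move: st; rewrite perm_sym -cat1s (permPl (permEl (perm_catCA t1 [:: a] t2))) perm_cons perm_sym.
Qed.

Lemma wsum_play s (G : nat -> seq nat -> nat) : symmetric_in2 G ->
  wsum (fun k => if k is w :: t then G w t else 0) (play s) = sum_outcomes s G.
Proof.
elim: s G => [|a s IHs] G sG; first by rewrite /wsum big_seq1 /= sum_outcomes_nil mul1n.
rewrite sum_outcomes_cons -IHs; last exact: symmetric_step.
rewrite /=; elim: (play s) => [|[[|w t] c] L IHL] /=; first by rewrite /wsum !big_nil.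
  by rewrite {}IHL {2}/wsum big_cons muln0.
rewrite !wsum_add_state {}IHL {2}/wsum big_cons mulnDr addnA; congr (_ * _ + _ * _ + _).
by apply: sG; exact: perm_insert_sorted.
Qed.

Section Scores.
Variables lo hi : nat.
(* [rem] games are still to be played by each of the vertices with scores [s]. *)
Definition viable rem s := all (fun a => (a <= hi) && (lo <= a + rem)) s.

Definition next_states rem (L : states_list) : states_list :=
  foldr (fun x acc => foldr (fun y acc =>
    if viable rem y.1 then add_state (sort_scores y.1) (N.mul y.2 x.2) acc else acc)
    acc (play x.1)) [::] L.

Fixpoint states rem k :=
  if k is k'.+1 then next_states rem (states rem.+1 k') else [:: ([::], 1%num)].

Definition labelledN n := foldr (fun x => N.add x.2) 0%num (states 0 n).

(** The number of ways to play all games when [rem] further vertices join, such that every final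
    score lies between [lo] and [hi]. *)
Fixpoint completions rem s : nat :=
  if rem is rem'.+1 then sum_outcomes s (fun w t => completions rem' (w :: t))
  else viable 0 s.

Lemma perm_completions rem s t : perm_eq s t -> completions rem s = completions rem t.
Proof.
elim: rem s t => [|rem IHrem] s t st /=; first by rewrite /viable (perm_all _ st).
by apply: perm_sum_outcomes st => w u u' uu'; apply: IHrem; rewrite perm_cons.
Qed.

Lemma viable_lose rem s r : size r = size s -> viable rem (lose s r) -> viable rem.+1 s.
Proof.
elim: s r => [|a s IHs] [|b r] //= [sz] /andP[/andP[ahi loa] /(IHs _ sz)->].
rewrite andbT; apply/andP; split; first by apply: leq_trans ahi; apply: leq_addr.
by apply: leq_trans loa _; rewrite addnS -addSn leq_add2r -addn1 leq_add2l leq_b1.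
Qed.

Lemma size_bits r k : r \in bits k -> size r = k.
Proof.
elim: k r => [|k IHk] r /=; first by rewrite inE => /eqP->.
by rewrite mem_cat => /orP[] /mapP[r' /IHk<- ->].
Qed.

(** Justifies the pruning in [next_states]: a round adds at most 1 to a score and uses up one
    remaining game, so a score out of reach stays out of reach. *)
Lemma completions_viable rem s : completions rem s != 0 -> viable rem s.
Proof.
elim: rem s => [|rem IHrem] s /=; first by case: viable.
apply: contraNT => nv; rewrite /sum_outcomes big_seq big1 // => r /size_bits sr.
apply: contraNeq nv => /IHrem /= /andP[_]; exact: viable_lose.
Qed.

Lemma wsum_next_states rem L :
  wsum (completions rem.+1) L <= wsum (completions rem) (next_states rem L).
Proof.
rewrite /next_states; elim: L => [|[s c] L IHL] /=; first by rewrite /wsum !big_nil.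
set acc := foldr _ [::] L in IHL *.
rewrite {1}/wsum big_cons /=; apply: leq_trans (leq_add (leqnn _) IHL) _.
rewrite -wsum_play; last by move=> w t t' tt'; apply: perm_completions; rewrite perm_cons.
elim: (play s) => [|[k c'] E IHE] /=; first by rewrite {1}/wsum big_nil muln0.
rewrite {1}/wsum big_cons mulnDr -addnA; apply: leq_trans (leq_add (leqnn _) IHE) _.
set acc' := foldr _ acc E; case: ifP => vk.
  rewrite wsum_add_state leq_add2r nat_of_mulN mulnA [_ * nat_of_bin c']mulnC leq_mul2l.
  apply/orP; right; rewrite (perm_completions _ (perm_sort_scores _)); by case: (k).
have : completions rem k = 0 by apply: contraFeq vk; exact: completions_viable.
by case: (k) => [_|w t g0]; rewrite /= ?g0 !muln0 add0n.
Qed.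

Lemma completions_states k : completions k [::] <= wsum (completions 0) (states 0 k).
Proof.
(* Adding a vertex moves one unit from [rem] to [k], so the sum stays constant along the
   induction. *)
suff H rem : completions (rem + k) [::] <= wsum (completions rem) (states rem k).
  exact: (H 0).
elim: k rem => [|k IHk] rem /=; first by rewrite /wsum big_seq1 mul1n addn0.
by rewrite addnS -addSn; apply: leq_trans (IHk _) (wsum_next_states _ _).
Qed.

Lemma completions_labelledN n : completions n [::] <= nat_of_bin (labelledN n).
Proof.
apply: leq_trans (completions_states n) _; rewrite /labelledN.
elim: (states 0 n) => [|[s c] L IHL] /=; first by rewrite /wsum big_nil.
rewrite nat_of_addN /wsum big_cons leq_add //=.
by case: viable; rewrite ?muln1 ?muln0.
Qed.

(** * Labelled tournaments as matrices, and their scores *)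

Fixpoint labelled k : seq mx :=
  if k is k'.+1 then [seq add_vertex M r | M <- labelled k', r <- bits k'] else [:: [::]].

Definition scores (M : mx) := [seq count id r | r <- M].

Lemma scores_addv M r : size r = size M ->
  scores (add_vertex M r) = count id r :: lose (scores M) r.
Proof.
rewrite /scores /add_vertex /= => sz; congr (_ :: _).
by elim: r M sz => [|b r IHr] [|row M] //= [sz]; rewrite IHr // addnC.
Qed.

Lemma size_labelled k M : M \in labelled k -> size M = k.
Proof.
elim: k M => [|k IHk] M /=; first by rewrite inE => /eqP->.
case/allpairsP=> -[M' r] [/= /IHk sM /size_bits sr ->] /=; congr _.+1.
by rewrite -sM in sr *; elim: r M' sr {sM} => [|b r IHr] [|row M'] //= [/IHr->].
Qed.

Lemma count_labelled n :
  count (fun M => viable 0 (scores M)) (labelled n) = completions n [::].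
Proof.
suff H rem k : \sum_(M <- labelled k) completions rem (scores M) = completions (rem + k) [::].
  by rewrite -(H 0 n) -sumn_count sumnE big_map.
elim: k rem => [|k IHk] rem /=; first by rewrite big_seq1 addn0.
rewrite addnS -addSn -IHk big_flatten big_map big_seq [RHS]big_seq.
apply: eq_bigr => M /size_labelled sM.
rewrite big_map [RHS]/= /sum_outcomes size_map sM big_seq [RHS]big_seq.
by apply: eq_bigr => r /size_bits sr; rewrite scores_addv ?sr.
Qed.

Section Labelled.
Variables (T : eqType) (d : rel T).
Hypothesis d_irr : forall x, d x x = false.
Hypothesis dC : forall x y, x != y -> d y x = ~~ d x y.

Lemma adj_labelled s : uniq s -> adj d s \in labelled (size s).
Proof.
elim: s => //= x s IHs /andP[xs us]; rewrite adj_cons //.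
apply/allpairsP; exists (adj d s, [seq d x y | y <- s]); split=> //=; first exact: IHs.
by have := mem_bits [seq d x y | y <- s]; rewrite size_map.
Qed.

Lemma scores_adj s : scores (adj d s) = [seq outdeg d s x | x <- s].
Proof.
by rewrite /scores /adj -map_comp; apply: eq_map => x /=; rewrite count_map.
Qed.

End Labelled.

Definition balanced n : {set tournament_on n} :=
  [set H | [forall x : tournament_of H,
     lo <= outdeg (@dom (tournament_of H)) (enum 'I_n) x <= hi]].

Lemma card_balanced n : #|balanced n| <= nat_of_bin (labelledN n).
Proof.
apply: leq_trans (completions_labelledN n); rewrite -count_labelled -size_filter.
pose f (H : tournament_on n) := adj (@dom (tournament_of H)) (enum 'I_n).
have inj_f : injective f.
  move=> H K HK; apply: val_inj; apply/setP=> -[x y].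
  have lt (z : 'I_n) : z < size (enum 'I_n) by rewrite size_enum_ord.
  by have := adj_inj HK x x (lt x) (lt y); rewrite !nth_ord_enum.
rewrite cardE -(size_map f); apply: uniq_leq_size.
  by rewrite map_inj_uniq ?enum_uniq.
move=> _ /mapP[H HB ->]; move: HB; rewrite mem_enum inE => /forallP HB.
rewrite mem_filter scores_adj /viable all_map.
have := @adj_labelled _ (@dom (tournament_of H)) (@dom_irr _) (@domC _) _ (enum_uniq 'I_n).
rewrite size_enum_ord => ->; rewrite andbT; apply/allP=> x _ /=.
by rewrite addn0 andbC; exact: HB.
Qed.

Lemma balanced_iso n H K : isomorphic (tournament_of H) (tournament_of K) ->
  H \in balanced n -> K \in balanced n.
Proof.
move=> [f [g fK gK] fE]; rewrite !inE => /forallP HB; apply/forallP=> y.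
suff -> : outdeg (@dom (tournament_of K)) (enum 'I_n) y =
          outdeg (@dom (tournament_of H)) (enum 'I_n) (g y) by exact: HB.
have cE (L : tournament_on n) x :
    outdeg (@dom (tournament_of L)) (enum 'I_n) x = #|[set z | dom x z]|.
  by rewrite cardsE cardE size_filter /outdeg enumT; apply: eq_count => z; rewrite inE.
rewrite !cE -(card_imset [set z | dom (g y) z] (can_inj fK)); congr #|pred_of_set _|.
apply/setP=> z; rewrite -[z]gK mem_imset ?inE; last exact: can_inj fK.
by rewrite -[y in LHS]gK fE.
Qed.

End Scores.

(** * Burnside's bound *)

Section Relabel.
Variable n : nat.
Implicit Types (D : {set 'I_n * 'I_n}) (s : 'S_n).

Definition relabel D s := [set p | (s^-1 p.1, s^-1 p.2)%g \in D].

Lemma relabel1 : relabel^~ 1%g =1 id.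
Proof. by move=> D; apply/setP=> -[x y]; rewrite inE /= invg1 !perm1. Qed.

Lemma relabelM D : act_morph relabel D.
Proof. by move=> s t; apply/setP=> -[x y]; rewrite !inE /= invMg !permM. Qed.

Definition relabel_action := TotalAction relabel1 relabelM.

Lemma mem_relabel D s x y : ((s x, s y) \in relabel D s) = ((x, y) \in D).
Proof. by rewrite inE /= !permK. Qed.

Definition fixed_labelled (A : {set tournament_on n}) s :=
  [set H in A | relabel (val H) s == val H].

(** The symmetric group acts on the arc sets of members of [A] because [A] is closed under
    isomorphism. Isomorphism classes correspond to orbits, which [Frobenius_Cauchy] counts. *)
Lemma card_cls_Burnside (A : {set tournament_on n}) :
  (forall H K, isomorphic (tournament_of H) (tournament_of K) -> H \in A -> K \in A) ->
  #|cls @: A| * n`! <= \sum_s #|fixed_labelled A s|.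
Proof.
move=> isoA; pose S := [set val H | H in A].
have relP (H : tournament_on n) s :
    is_tournament (fun x y => (x, y) \in relabel (val H) s).
  have [as_ tot] := andP (valP H).
  apply/andP; split; apply/forallP=> x; apply/forallP=> y; rewrite !inE /=.
    exact: (forallP (forallP as_ _)).
  rewrite -(inj_eq (@perm_inj _ s^-1%g)).
  exact: (forallP (forallP tot _)).
have relI H s : exists2 K : tournament_on n,
    val K = relabel (val H) s & isomorphic (tournament_of H) (tournament_of K).
  exists (exist _ (relabel (val H) s) (relP H s)) => //.
  by exists s; [exists s^-1%g; [exact: permK | exact: permKV] | move=> x y; rewrite /= mem_relabel].
have actS : [acts [set: 'S_n], on S | relabel_action].
  apply/subsetP=> s _; rewrite !inE; apply/subsetP=> _ /imsetP[H HA ->].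
  rewrite inE /=; have [K <- HK] := relI H s.
  by apply: imset_f; apply: isoA HA.
have := Frobenius_Cauchy actS; rewrite cardsT card_Sn => FC.
have -> : \sum_s #|fixed_labelled A s| =
          \sum_(s in [set: 'S_n]) #|'Fix_(S | relabel_action)[s]%g|.
  apply: eq_big => [s|s _]; first by rewrite inE.
  rewrite -(card_imset _ val_inj); congr #|pred_of_set _|; apply/setP=> D.
  rewrite !inE; apply/imsetP/andP.
    case=> H; rewrite inE => /andP[HA fixH] ->; split; first exact: imset_f.
    by apply/subsetP => s'; rewrite !inE => /eqP->.
  case=> /imsetP[H HA ->] fixH; exists H; rewrite // inE HA.
  by move/subsetP/(_ s): fixH; rewrite !inE; apply.
rewrite FC leq_mul2r; apply/orP; right.
(* Orbits consist of arc sets, classes of tournaments; [c] converts the former, and every class is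
   the image of an orbit. *)
pose c O : {set tournament_on n} := [set K | val K \in (O : {set {set 'I_n * 'I_n}})].
apply: leq_trans (leq_imset_card c _); apply/subset_leq_card/subsetP => _ /imsetP[H HA ->].
apply/imsetP; exists (action.orbit relabel_action [set: 'S_n] (val H)).
  by apply: imset_f; apply: imset_f.
apply/setP=> K; rewrite !inE; apply/asboolP/orbitP.
  case=> f bf fE; have inj_f : injective f by apply: bij_inj.
  exists (perm inj_f); rewrite ?inE //=; apply/setP=> -[x y].
  rewrite inE /=; have [g fK gK] := bf.
  have permVE z : (perm inj_f)^-1%g z = g z by rewrite -[z in LHS]gK -[f _](permE inj_f) permK.
  by rewrite !permVE -[x in RHS]gK -[y in RHS]gK; apply/esym/fE.
case=> s _ /= sH; have [K' K'E] := relI H s.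
by rewrite (_ : K' = K) //; apply: val_inj; rewrite K'E.
Qed.

End Relabel.

Section FixedBound.
Variables (n : nat) (A : {set tournament_on n}) (s : 'S_n).
Implicit Types H K : tournament_on n.

Definition nfix := #|[set x | s x == x]|.

Lemma fixed_power H k x y : H \in fixed_labelled A s ->
  ((((s ^+ k)%g x, (s ^+ k)%g y) \in val H) = ((x, y) \in val H)).
Proof.
rewrite inE => /andP[_ /eqP fixH]; elim: k => [|k IHk]; first by rewrite !perm1.
by rewrite expgSr !permM -IHk -[in LHS]fixH mem_relabel.
Qed.

(** Otherwise invariance would identify the arc from [x] to [y] with its reverse. *)
Lemma fixed_noswap H k x y : H \in fixed_labelled A s ->
  (s ^+ k)%g x = y -> (s ^+ k)%g y = x -> x = y.
Proof.
move=> fixH sx sy; apply/eqP; apply: contraT => neq.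
have := fixed_power k x y fixH; rewrite sx sy.
by have := @domC (tournament_of H) x y neq; rewrite /= => ->; case: (_ \in _).
Qed.

(** If the order were [2m], then [s ^+ m] would be an involution other than the identity, hence swap
    two vertices. *)
Lemma fixed_odd H : H \in fixed_labelled A s -> odd #[s]%g.
Proof.
move=> fixH; apply: contraT => ev.
have [m mE] : exists m, #[s]%g = m.*2.
  by exists #[s]%g./2; rewrite -[LHS]odd_double_half (negbTE ev).
have m0 : 0 < m by rewrite -double_gt0 -mE order_gt0.
have /eqP[] : (s ^+ m)%g != 1%g.
  apply/negP => /eqP/eqP; rewrite -order_dvdn mE => /dvdn_leq -/(_ m0).
  by rewrite -addnn leqNgt -[X in X < _]add0n ltn_add2r m0.
apply/permP => x; rewrite perm1; apply/esym/(fixed_noswap (k := m) fixH erefl).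
by rewrite -permM -expgD addnn -mE expg_order perm1.
Qed.

Definition pair_orbits :=
  action.orbit ('P^* : action _ _)%act <[s]>%g @: [set B : {set 'I_n} | #|B| == 2].

Lemma acts_pairs : [acts <[s]>%g, on [set B : {set 'I_n} | #|B| == 2] | 'P^*].
Proof.
apply/subsetP=> t _; rewrite !inE; apply/subsetP=> B; rewrite !inE => /eqP <-.
by rewrite card_setact.
Qed.

(* [s] has odd order, so that an orbit with at most 2 elements is a fixed pair. *)
Lemma card_pair_orbits H : H \in fixed_labelled A s ->
  3 * #|pair_orbits| <= 'C(n, 2) + 2 * 'C(nfix, 2).
Proof.
move=> fixH; have := acts_sum_card_orbit acts_pairs; rewrite -/pair_orbits.
have -> : #|[set B : {set 'I_n} | #|B| == 2]| = 'C(n, 2).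
  by rewrite card_draws card_ord.
move=> <-; pose F := [set O in pair_orbits | #|O| == 1].
have leF : #|F| <= 'C(nfix, 2).
  rewrite -cards_draws.
  rewrite -(card_imset [set B : {set 'I_n} | _] set1_inj).
  apply/subset_leq_card/subsetP => O; rewrite inE => /andP[/imsetP[B]].
  rewrite inE => /cards2P[x [y [neq BE]]] OE /cards1P[B' B'E].
  have BO : B \in O by rewrite OE orbit_refl.
  have sBO : ('P^* B s)%act \in O by rewrite OE mem_orbit ?cycle_id.
  have BB' : B = B' by move: BO; rewrite B'E inE => /eqP.
  have sB : ('P^* B s)%act = B by move: sBO; rewrite B'E inE BB' => /eqP.
  apply/imsetP; exists B; last by rewrite B'E BB'.
  have sxy z : z \in B -> s z \in B by move=> zB; rewrite -sB; apply: imset_f.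
  rewrite inE BE cards2 neq andbT; apply/subsetP.
  have sx := sxy x; have sy := sxy y.
  rewrite BE !inE !eqxx orbT /= in sx sy.
  (* If [s x = y], then [s y = x] is a forbidden swap and [s y = y] contradicts injectivity. *)
  have sxE : s x == x.
    case/orP: (sx isT) => // /eqP sxy'; case/orP: (sy isT) => /eqP syx.
      by case/eqP: neq; apply: (fixed_noswap (k := 1) fixH); rewrite expg1.
    by case/eqP: neq; apply: (@perm_inj _ s); rewrite sxy' syx.
  have syE : s y == y.
    case/orP: (sy isT) => // /eqP syx; case/eqP: neq; apply: (@perm_inj _ s).
    by rewrite syx (eqP sxE).
  by move=> z; rewrite !inE => /orP[] /eqP->.
(* Orbit sizes are odd, so each is at least 3 or equal to 1; an orbit of size 1 is counted in [F],
   and the term [2 * #|F|] raises its contribution to 3. *)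
apply: leq_trans (_ : \sum_(O in pair_orbits) #|O| + 2 * #|F| <= _); last first.
  by rewrite leq_add2l leq_mul2l leF orbT.
have -> : #|F| = \sum_(O in pair_orbits) (#|O| == 1).
  by rewrite -sum1_card big_mkcond [RHS]big_mkcond; apply: eq_bigr => O _;
    rewrite [O \in F]inE; case: (O \in pair_orbits) => //=; case: eqP.
rewrite big_distrr -big_split -sum1_card big_distrr /=; apply: leq_sum => O /imsetP[B _ ->].
have : odd #|action.orbit 'P^* <[s]>%g B|.
  apply: dvdn_odd (fixed_odd fixH); rewrite orderE; exact: dvdn_orbit.
by case: #|_| => [|[|[|k]]].
Qed.

(* An invariant tournament is determined by one arc in each orbit of pairs. *)
Lemma card_fixed_le H0 : H0 \in fixed_labelled A s ->
  #|fixed_labelled A s| <= 2 ^ #|pair_orbits|.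
Proof.
move=> fixH0; rewrite -card_powerset.
pose r (O : {set {set 'I_n}}) :=
  [pick p : 'I_n * 'I_n | (p.1 != p.2) && ([set p.1; p.2] \in O)].
pose code (H : tournament_on n) :=
  [set O in pair_orbits | if r O is Some p then p \in val H else false].
rewrite -(card_in_imset (f := code)).
  apply/subset_leq_card/subsetP=> _ /imsetP[H _ ->].
  by rewrite inE; apply/subsetP=> O; rewrite inE => /andP[].
move=> H K fixH fixK HK; apply: val_inj; apply/setP => -[x y].
have [<-|neq] := eqVneq x y.
  have := dom_irr (T := tournament_of H) x; have := dom_irr (T := tournament_of K) x.
  by rewrite /= => -> ->.
pose O := action.orbit 'P^* <[s]>%g [set x; y].
have OP : O \in pair_orbits by apply: imset_f; rewrite inE cards2 neq.
have : (O \in code H) = (O \in code K) by rewrite HK.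
rewrite !inE OP /= /r; case: pickP => [[a b] /= /andP[nab abO]|/(_ (x, y))]; last first.
  by rewrite /= neq orbit_refl.
(* A power of [s] carries the pair of [x] and [y] to the chosen pair, possibly in reversed order, in
   which case the arc is negated for both tournaments. *)
have /orbitP[_ /cycleP[k ->] abE] := abO.
have skxy : (s ^+ k)%g x \in [set a; b] /\ (s ^+ k)%g y \in [set a; b].
  by rewrite -abE; split; apply: imset_f; rewrite !inE eqxx ?orbT.
rewrite -(fixed_power k x y fixH) -(fixed_power k x y fixK).
have nsk : (s ^+ k)%g x != (s ^+ k)%g y by rewrite (inj_eq perm_inj).
case: skxy; rewrite !inE => /orP[] /eqP xE /orP[] /eqP yE; move: nsk; rewrite xE yE ?eqxx // => _.
have dE (L : tournament_on n) : ((b, a) \in val L) = ~~ ((a, b) \in val L).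
  exact: (@domC (tournament_of L) a b nab).
by rewrite !dE => ->.
Qed.

(** A moved vertex [x] gives three distinct moved vertices [x], [s x] and [s (s x)], as swaps are
    excluded. *)
Lemma nfix_le H : s != 1%g -> H \in fixed_labelled A s -> nfix + 3 <= n.
Proof.
move=> s1 fixH.
have [x sx] : exists x, s x != x.
  apply/existsP; apply: contraNT s1 => /existsPn H'; apply/eqP/permP=> x.
  by rewrite perm1; apply/eqP; have := H' x; rewrite negbK.
have ssx : s (s x) != x.
  by apply: contraNneq sx => ssx; apply/eqP/esym; apply: (fixed_noswap (k := 1) fixH); rewrite expg1.
pose B := [set x; s x; s (s x)].
have cB : #|B| = 3.
  by rewrite /B setUC cardsU1 cards2 !inE (inj_eq perm_inj) (negbTE sx) (negbTE ssx) eq_sym sx.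
rewrite -[leqRHS]card_ord -cardsT -cB -(cardsID [set x | s x == x] setT) setTI leq_add2l.
apply/subset_leq_card/subsetP => y; rewrite !inE andbT.
by case/orP => [/orP[]|] /eqP->; rewrite ?(inj_eq perm_inj).
Qed.

Lemma card_fixed : s != 1%g ->
  #|fixed_labelled A s| <=
  if nfix + 3 <= n then 2 ^ (('C(n, 2) + 2 * 'C(nfix, 2)) %/ 3) else 0.
Proof.
move=> s1; have [->|/set0Pn[H fixH]] := eqVneq (fixed_labelled A s) set0.
  by rewrite cards0.
rewrite (nfix_le s1 fixH); apply: leq_trans (card_fixed_le fixH) _.
by rewrite leq_pexp2l // leq_divRL // mulnC (card_pair_orbits fixH).
Qed.

End FixedBound.

(** * Moments of the number of fixed points of a permutation *)

Section FixedPoints.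
Variable n : nat.
Implicit Types s : 'S_n.

Lemma card_perm_fixing (K : {set 'I_n}) :
  #|[set s : 'S_n | K \subset [set x | s x == x]]| = (n - #|K|)`!.
Proof.
have -> : n - #|K| = #|~: K| by rewrite [RHS]cardsCs setCK card_ord.
rewrite -card_perm -[RHS]cardsE; congr #|pred_of_set _|; apply/setP=> s.
rewrite !inE /perm_on; apply/subsetP/subsetP => H x; rewrite !inE => xP.
  by apply: contra xP => /H; rewrite inE.
by apply: contraLR xP => /H; rewrite inE.
Qed.

(** Double counting of the pairs of a permutation and a [k]-set that it fixes pointwise. *)
Lemma sum_bin_nfix k : \sum_(s : 'S_n) 'C(nfix s, k) = 'C(n, k) * (n - k)`!.
Proof.
transitivity (\sum_(s : 'S_n) \sum_(K : {set 'I_n} | #|K| == k) (K \subset [set x | s x == x])).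
  apply: eq_bigr => s _; rewrite /nfix -cards_draws -sum1_card big_mkcond [RHS]big_mkcond.
  apply: eq_bigr => K _; rewrite inE; case: (_ \subset _) => //=; by case: (#|K| == k).
rewrite exchange_big /= -[n in 'C(n, _)]card_ord -card_draws -sum1_card big_distrl /=.
rewrite [RHS]big_mkcond [LHS]big_mkcond; apply: eq_bigr => K _; rewrite inE.
case: eqP => // <-; rewrite mul1n -card_perm_fixing -sum1_card [RHS]big_mkcond.
by apply: eq_bigr => s _; rewrite inE; case: ifP.
Qed.

Definition num_nfix f := #|[set s : 'S_n | nfix s == f]|.

Lemma nfix_ltn s : nfix s < n.+1.
Proof. by rewrite ltnS -[leqRHS]card_ord max_card. Qed.

Lemma sum_nfix (w : nat -> nat) : \sum_(s : 'S_n) w (nfix s) = \sum_(f < n.+1) num_nfix f * w f.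
Proof.
rewrite (partition_big (fun s => Ordinal (nfix_ltn s)) predT) //=.
apply: eq_bigr => f _; rewrite /num_nfix -sum1_card big_distrl /=.
apply: eq_big => [s|s /eqP<-]; first by rewrite inE -val_eqE.
by rewrite mul1n.
Qed.

(** Vanishes for the identity, whose [n] fixed points violate [f + 3 <= n]; the identity contributes
    all of [A] separately. *)
Definition fix_weight f :=
  if f + 3 <= n then 2 ^ (('C(n, 2) + 2 * 'C(f, 2)) %/ 3) else 0.

Lemma card_cls_labelled (A : {set tournament_on n}) :
  (forall H K, isomorphic (tournament_of H) (tournament_of K) -> H \in A -> K \in A) ->
  #|cls @: A| * n`! <= #|A| + \sum_(f < n.+1) num_nfix f * fix_weight f.
Proof.
move=> isoA; apply: leq_trans (card_cls_Burnside isoA) _.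
rewrite (bigD1 1%g) //=; apply: leq_add.
  by apply/subset_leq_card/subsetP=> H; rewrite inE => /andP[].
rewrite -(sum_nfix fix_weight) [leqRHS](bigID (pred1 1%g)) /= -[leqLHS]add0n leq_add //.
by apply: leq_sum => s; exact: card_fixed.
Qed.

Lemma moment_nfix k : \sum_(f < n.+1) num_nfix f * 'C(f, k) = 'C(n, k) * (n - k)`!.
Proof. by rewrite -(sum_nfix (fun f => 'C(f, k))) sum_bin_nfix. Qed.

End FixedPoints.

(** * Evaluation of the Burnside bound in binary arithmetic *)

Definition sumN (F : nat -> N) m : N := foldr (fun i => N.add (F i)) 0%num (iota 0 m).
Fixpoint binN (n k : nat) : N :=
  match n, k with
  | _, 0 => 1%num
  | 0, _.+1 => 0%num
  | n'.+1, k'.+1 => N.add (binN n' k'.+1) (binN n' k')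
  end.
Fixpoint factN (n : nat) : N := if n is n'.+1 then N.mul (N.of_nat n) (factN n') else 1%num.
Definition pow2N k : N := iter k (N.mul 2) 1%num.

Lemma nat_of_sumN F m : nat_of_bin (sumN F m) = \sum_(i < m) nat_of_bin (F i).
Proof.
rewrite -(big_mkord xpredT (fun i => nat_of_bin (F i))) /index_iota subn0 /sumN.
elim: (iota 0 m) => [|i s IHs] /=; first by rewrite big_nil.
by rewrite big_cons nat_of_addN IHs.
Qed.

Lemma nat_of_binN n k : nat_of_bin (binN n k) = 'C(n, k).
Proof. by elim: n k => [|n IHn] [|k] //=; rewrite nat_of_addN !IHn. Qed.

Lemma nat_of_factN n : nat_of_bin (factN n) = n`!.
Proof.
elim: n => // n IHn; rewrite factS -IHn.
have -> : factN n.+1 = N.mul (N.of_nat n.+1) (factN n) by [].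
by rewrite nat_of_mulN [nat_of_bin (N.of_nat _)]nat_of_binE Nat2N.id.
Qed.

Lemma nat_of_pow2N k : nat_of_bin (pow2N k) = 2 ^ k.
Proof. by elim: k => // k IHk; rewrite expnS -IHk /pow2N iterS nat_of_mulN. Qed.

Lemma leq_nat_of_bin a b : N.leb a b -> nat_of_bin a <= nat_of_bin b.
Proof. by rewrite !nat_of_binE => /N.leb_le H; apply/leP; lia. Qed.

Lemma leq_nat_of_div x a b : N.ltb 0 b -> x * nat_of_bin b <= nat_of_bin a ->
  x <= nat_of_bin (N.div a b).
Proof.
rewrite !nat_of_binE => /N.ltb_lt b0 /leP; rewrite -multE -{1}[x]Nat2N.id -N2Nat.inj_mul => H.
have : (N.of_nat x <= N.div a b)%num by apply: N.div_le_lower_bound; lia.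
by move=> H'; apply/leP; lia.
Qed.

Definition weightN n f : N :=
  if f + 3 <= n then pow2N (('C(n, 2) + 2 * 'C(f, 2)) %/ 3) else 0%num.
Definition momentN n k : N := N.mul (binN n k) (factN (n - k)).

(* The moments of the number of fixed points are known for binomial coefficients.
   Newton's forward differences write [weightN n] as a combination of those;
   [p] and [q] are its positive and negative parts. *)
Definition newtonN n (p q : nat -> N) :=
  all (fun f => N.eqb (N.add (weightN n f) (sumN (fun k => N.mul (q k) (binN f k)) n.+1))
                      (sumN (fun k => N.mul (p k) (binN f k)) n.+1)) (iota 0 n.+1).

(** Multiply the identity checked by [newtonN] at each [f] by the number of permutations with [f]
    fixed points and sum over [f]; [moment_nfix] evaluates the binomial sums. The negative part
    stays on the left to avoid truncated subtraction. *)
Lemma sum_weights n (p q : nat -> N) : newtonN n p q ->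
  \sum_(f < n.+1) num_nfix n f * fix_weight n f
    + nat_of_bin (sumN (fun k => N.mul (q k) (momentN n k)) n.+1)
  = nat_of_bin (sumN (fun k => N.mul (p k) (momentN n k)) n.+1).
Proof.
move=> /allP newton.
have momE (r : nat -> N) : nat_of_bin (sumN (fun k => N.mul (r k) (momentN n k)) n.+1)
    = \sum_(f < n.+1) num_nfix n f * nat_of_bin (sumN (fun k => N.mul (r k) (binN f k)) n.+1).
  rewrite nat_of_sumN; under [RHS]eq_bigr do rewrite nat_of_sumN big_distrr.
  rewrite exchange_big; apply: eq_bigr => k _.
  rewrite !nat_of_mulN nat_of_binN nat_of_factN -moment_nfix big_distrr.
  by apply: eq_bigr => f _; rewrite nat_of_mulN nat_of_binN; exact: mulnCA.
rewrite !momE -big_split; apply: eq_bigr => f _ /=; rewrite -mulnDr; congr (_ * _).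
have /newton/N.eqb_eq <- : (f : nat) \in iota 0 n.+1 by rewrite mem_iota add0n ltn_ord.
rewrite nat_of_addN; congr (_ + _); rewrite /fix_weight /weightN.
by case: ifP => // _; rewrite nat_of_pow2N.
Qed.

(** A pair [(a, b)] stands for the integer [a - b], and this is [y - x]. Truncated subtraction
    leaves at least one component zero. *)
Definition subpair (x y : N * N) : N * N :=
  let a := N.add y.1 x.2 in let b := N.add y.2 x.1 in (N.sub a b, N.sub b a).
Fixpoint differences (s : seq (N * N)) : seq (N * N) :=
  if s is x :: s' then if s' is y :: _ then subpair x y :: differences s' else [::] else [::].
(** The leading entries of the iterated difference table. That they are the right coefficients is
    established by evaluating [newtonN]. *)
Definition newton_coefs n :=
  [seq head (0%num, 0%num) (iter k differences [seq (weightN n f, 0%num) | f <- iota 0 n.+1])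
  | k <- iota 0 n.+1].
Definition posN n k := (nth (0%num, 0%num) (newton_coefs n) k).1.
Definition negN n k := (nth (0%num, 0%num) (newton_coefs n) k).2.

Definition nontrivial_fixN n : N :=
  N.sub (sumN (fun k => N.mul (posN n k) (momentN n k)) n.+1)
        (sumN (fun k => N.mul (negN n k) (momentN n k)) n.+1).
Definition classesN lo hi n : N :=
  N.div (N.add (labelledN lo hi n) (nontrivial_fixN n)) (factN n).

Lemma card_cls_balanced lo hi n : newtonN n (posN n) (negN n) -> N.ltb 0 (factN n) ->
  #|cls @: balanced lo hi n| <= nat_of_bin (classesN lo hi n).
Proof.
move=> newton fact0; apply: leq_nat_of_div => //; rewrite nat_of_factN.
apply: leq_trans (card_cls_labelled (@balanced_iso lo hi n)) _.
rewrite nat_of_addN leq_add ?card_balanced //.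
rewrite /nontrivial_fixN [leqRHS]nat_of_binE N2Nat.inj_sub -!nat_of_binE.
by rewrite -(sum_weights newton) minusE addnK.
Qed.

(** * Upper bounds *)

Section Retentive.
Variables (n : nat) (H : tournament_on n).
Hypotheses (n1 : 1 < n) (retH : retentive_tournament (tournament_of H)).
Let T := tournament_of H.

(** The condition says that every arc lies on a 3-cycle, which also holds in the converse
    tournament. *)
Lemma retentive_uncovered c : uncovered (@orient c T) (enum 'I_n).
Proof.
move=> u z _ _ zu.
have unc := @retentive_tournament_uncovered T retH.
rewrite /orient in zu *; case: c zu => /unc[y uy yz]; exists y; rewrite ?mem_enum //.
  by rewrite yz.
by rewrite uy.
Qed.

Lemma outdeg_orient (x : T) :
  outdeg (@orient true T) (enum 'I_n) x = n.-1 - outdeg (@orient false T) (enum 'I_n) x.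
Proof.
rewrite /outdeg; have /(perm_to_rem (s := enum 'I_n)) ps : x \in enum 'I_n by rewrite mem_enum.
have sz : size (rem x (enum 'I_n)) = n.-1 by rewrite size_rem ?mem_enum // size_enum_ord.
have cE c : count (@orient c T x) (x :: rem x (enum 'I_n)) =
            count (@orient c T x) (rem x (enum 'I_n)).
  by move: (@orient c T) (@orient_irr c T x) => e exx; rewrite /= exx.
rewrite !(seq.permP ps) !cE -sz -(count_predC (orient false x)) addKn.
apply: eq_in_count => y; rewrite mem_rem_uniq ?enum_uniq // !inE => /andP[neq _].
by apply: (@orientC false T x y); rewrite eq_sym.
Qed.

Lemma realized_low_splits c (x : T) Z1 Z2 : outdeg (@orient c T) (enum 'I_n) x < 3 ->
  (forall zs : seq T, uniq zs -> size zs = n - 2 -> realized (@orient c T) Z1 zs) ->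
  (forall zs : seq T, uniq zs -> size zs = n - 3 -> realized (@orient c T) Z2 zs) ->
  realized (@orient c T) (splits 1 (n - 2) Z1 ++ splits 2 (n - 3) Z2) (enum 'I_n).
Proof.
move=> dx Z1P Z2P; have unc := @retentive_uncovered c.
have xs : x \in enum 'I_n by rewrite mem_enum.
have sz : size (enum 'I_n) = n by rewrite size_enum_ord.
have oC := @orientC c T; have oI := @orient_irr c T.
have d0 : 0 < outdeg (@orient c T) (enum 'I_n) x.
  by apply: outdeg_gt0; rewrite ?sz ?enum_uniq.
have := @realized_splits_at _ _ oI oC _ (enum 'I_n) x (enum_uniq 'I_n) xs (fun z zs => unc x z xs zs).
rewrite sz -subn1 -subnDA; case: (outdeg _ _ x) d0 dx => [|[|[|//]]] // _ _ H'.
  by apply: realized_sub (H' _ Z1P) => M; rewrite mem_cat => ->.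
by apply: realized_sub (H' _ Z2P) => M; rewrite mem_cat orbC => ->.
Qed.

End Retentive.

(** A score outside the interval from 3 to [n - 4] is at most 2 or at least [n - 3]; in the latter
    case it is at most 2 in the converse. The list [L] serves both orientations and is counted
    twice. *)
Lemma beta_le_split n L : 1 < n ->
  (forall c H, retentive_tournament (tournament_of H) ->
     (exists x, outdeg (@orient c (tournament_of H)) (enum 'I_n) x < 3) ->
     realized (@orient c (tournament_of H)) L (enum 'I_n)) ->
  beta n <= #|cls @: balanced 3 (n - 4) n| + (size L + size L).
Proof.
move=> n1 LP; rewrite betaE.
pose low c := [set H in @retentive_on n |
  [exists x : tournament_of H, outdeg (@orient c (tournament_of H)) (enum 'I_n) x < 3]].
have sub : retentive_on n \subset balanced 3 (n - 4) n :|: (low false :|: low true).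
  apply/subsetP=> H retH; rewrite !in_setU [H \in low false]inE [H \in low true]inE retH !andTb.
  have [//|nb] := boolP (H \in balanced 3 (n - 4) n).
  have [x] : exists x : tournament_of H,
      ~~ (2 < outdeg (@orient false (tournament_of H)) (enum 'I_n) x <= n - 4).
    by move: nb; rewrite inE => /forallPn.
  rewrite orFb.
  rewrite negb_and -!ltnNge => /orP[lo|hi].
    by apply/orP; left; apply/existsP; exists x.
  apply/orP; right; apply/existsP; exists x.
  rewrite outdeg_orient // ltnS leq_subLR; move: hi.
  move: (outdeg _ _ _) => [|d] //; rewrite ltnS leq_subLR => hi.
  by rewrite -ltnS prednK ?(ltnW n1) // (leq_trans hi) // addnC !addSn !addnS.
apply: leq_trans (card_cls_sub sub) _; apply: leq_trans (card_clsU _ _) _.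
rewrite leq_add2l; apply: leq_trans (card_clsU _ _) _.
by apply: leq_add; apply: card_cls_le => H; rewrite inE => /andP[];
   rewrite inE => /asboolP retH /existsP; apply: LP.
Qed.

Lemma size_up_to_iso L : size (up_to_iso L) <= size L.
Proof.
rewrite size_map; elim: L => //= M L IHL; case: ifP => _ //=.
exact: leqW.
Qed.

Lemma size_crossings d m : size (crossings d m) = size (filter (has id) (bits d)) ^ m.
Proof. by elim: m => //= m IHm; rewrite size_allpairs IHm expnS. Qed.

Lemma size_splits d m Zs :
  size (splits d m Zs) = size (tournaments d) * size Zs * size (filter (has id) (bits d)) ^ m.
Proof. by rewrite /splits !size_allpairs size_crossings. Qed.

(** Bounds the size of [tournaments 8] without enumerating it. *)
Lemma size_tournamentsS k : size (tournaments k.+1) <= size (tournaments k) * 2 ^ k.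
Proof.
apply: leq_trans (size_up_to_iso _) _; rewrite size_allpairs leq_mul2l.
rewrite -[2 ^ k](_ : size (bits k) = _) ?leqnn ?orbT //.
by elim: k => //= k IHk; rewrite size_cat !size_map IHk expnS mul2n addnn.
Qed.

Lemma beta_le_uncovered n : 1 < n -> beta n <= size (uncovered_tournaments n).
Proof.
move=> n1; rewrite betaE; apply: (@card_cls_le n false) => H; rewrite inE => /asboolP retH.
have := @realized_uncovered _ _ (@orient_irr false (tournament_of H))
  (@orientC false (tournament_of H)) (enum 'I_n) (enum_uniq 'I_n).
by rewrite size_enum_ord; apply=> //; apply: retentive_uncovered.
Qed.

Lemma realized_tournaments_size (T : eqType) (d : rel T) k (s : seq T) :
  (forall x, d x x = false) -> (forall x y, x != y -> d y x = ~~ d x y) ->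
  uniq s -> size s = k -> realized d (tournaments k) s.
Proof. by move=> dI dC us <-; apply: realized_tournaments. Qed.

Definition sizeN (T : Type) (s : seq T) : N := foldr (fun _ => N.succ) 0%num s.

Lemma nat_of_sizeN (T : Type) (s : seq T) : nat_of_bin (sizeN s) = size s.
Proof. by elim: s => //= x s <-; rewrite -N.add_1_l nat_of_addN. Qed.

Definition low_splits n (Z1 Z2 : seq mx) := splits 1 (n - 2) Z1 ++ splits 2 (n - 3) Z2.

Definition boundN (q s : N) : N := N.add q (N.mul 2 s).

Lemma leq_boundN x q s t : x <= nat_of_bin q + (t + t) -> t <= nat_of_bin s ->
  x <= nat_of_bin (boundN q s).
Proof.
move=> xq ts; apply: leq_trans xq _.
by rewrite nat_of_addN leq_add2l nat_of_mulN addnn -mul2n leq_mul2l ts orbT.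
Qed.

Lemma beta_le_low n L : 1 < n -> newtonN n (posN n) (negN n) -> N.ltb 0 (factN n) ->
  (forall c H, retentive_tournament (tournament_of H) ->
     (exists x, outdeg (@orient c (tournament_of H)) (enum 'I_n) x < 3) ->
     realized (@orient c (tournament_of H)) L (enum 'I_n)) ->
  beta n <= nat_of_bin (classesN 3 (n - 4) n) + (size L + size L).
Proof.
move=> n1 newton fact0 LP; apply: leq_trans (beta_le_split n1 LP) _.
by rewrite leq_add2r card_cls_balanced.
Qed.

Lemma realized_low_tournaments n c (H : tournament_on n) : 1 < n ->
  retentive_tournament (tournament_of H) ->
  (exists x, outdeg (@orient c (tournament_of H)) (enum 'I_n) x < 3) ->
  realized (@orient c (tournament_of H))
    (low_splits n (tournaments (n - 2)) (tournaments (n - 3))) (enum 'I_n).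
Proof.
move=> n1 retH [x xlow]; apply: (realized_low_splits n1 retH xlow).
  by move=> zs; apply: realized_tournaments_size; [exact: orient_irr|exact: orientC].
by move=> zs; apply: realized_tournaments_size; [exact: orient_irr|exact: orientC].
Qed.

Lemma beta9_le : beta 9 <=
  nat_of_bin (boundN (classesN 3 5 9)
    (sizeN (filter uncovered_mx (low_splits 9 (tournaments 7) (tournaments 6))))).
Proof.
apply: leq_boundN; last by rewrite nat_of_sizeN; exact: leqnn.
apply: (@beta_le_low 9); [by []|by vm_compute|by []|].
move=> c H retH xlow; apply: realized_filter_uncovered.
- exact: orient_irr.
- exact: orientC.
- exact: enum_uniq.
- exact: retentive_uncovered.
exact: (@realized_low_tournaments 9).
Qed.

Lemma size_low_splits n Z1 Z2 : size (low_splits n Z1 Z2) = size Z1 + size Z2 * 3 ^ (n - 3).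
Proof.
rewrite size_cat !size_splits.
have -> : size (tournaments 1) = 1 by vm_compute.
have -> : size (tournaments 2) = 1 by vm_compute.
have -> : size (filter (has id) (bits 1)) = 1 by [].
have -> : size (filter (has id) (bits 2)) = 3 by [].
by rewrite !mul1n exp1n muln1.
Qed.

(* [2187 = 3 ^ 7]: each of the 7 in-neighbours of a vertex of outdegree 2 dominates
   at most one of its out-neighbours. *)
Lemma beta10_le : beta 10 <=
  nat_of_bin (boundN (classesN 3 6 10) (N.mul (sizeN (tournaments 7)) (N.add (pow2N 7) 2187))).
Proof.
apply: leq_boundN.
  apply: (@beta_le_low 10 (low_splits 10 (tournaments 8) (tournaments 7))); [by []|by vm_compute|by []|].
  by move=> c H retH xlow; exact: (@realized_low_tournaments 10).
(* Both lists are generalised, so that the following steps cannot unfold them. *)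
have := size_tournamentsS 7; move: (tournaments 8) (tournaments 7) => Z1 Z2 leZ.
by rewrite size_low_splits nat_of_mulN nat_of_sizeN nat_of_addN nat_of_pow2N mulnDr leq_add2r.
Qed.

Lemma bound9_computed :
  N.leb (boundN (classesN 3 5 9)
    (sizeN (filter uncovered_mx (low_splits 9 (tournaments 7) (tournaments 6))))) 30596.
Proof. vm_cast_no_check (erefl true). Qed.

Lemma bound10_computed :
  N.leb (boundN (classesN 3 6 10) (N.mul (sizeN (tournaments 7)) (N.add (pow2N 7) 2187))) 3881175.
Proof. vm_cast_no_check (erefl true). Qed.

Lemma size_uncovered8 : size (uncovered_tournaments 8) <= 395.
Proof. vm_cast_no_check (erefl true). Qed.

(** A proper closed list [r] of indices would give a vertex set [X] contradicting
    [retentive_tournament_expand]: the vertex [u] found there is uncovered in the in-neighbourhood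
    of [v], so closedness puts its index in [r]. *)
Lemma retentive_strong_mx (H : tournament) (s : seq H) :
  retentive_tournament H -> perm_eq s (enum H) -> strong_mx (adj (@dom H) s).
Proof.
move=> retH ps; have us : uniq s by rewrite (perm_uniq ps) enum_uniq.
have ins x : x \in s by rewrite (perm_mem ps) mem_enum.
rewrite /strong_mx size_map; apply/hasPn => i; rewrite mem_iota /= add0n => lti.
apply/negP; rewrite size_iota; set r := closure _ _ _.
case: ifP => // /andP[ltr ir] /allP clr.
have x0 : H by case: (s) lti.
have idx x : index x s < size s by rewrite index_mem.
have entryE x y : entry (adj (@dom H) s) (index x s) (index y s) = dom x y.
  by rewrite (entry_adj _ x0) ?nth_index.
pose X := [set v | index v s \in r].
have [||v [u [vX uX uv unc]]] := @retentive_tournament_expand H retH X.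
- by apply/set0Pn; exists (nth x0 s i); rewrite inE index_uniq.
- apply/eqP => XT; move: ltr; rewrite ltnNge => /negP; apply.
  rewrite -[leqLHS](size_iota 0); apply: uniq_leq_size; first exact: iota_uniq.
  move=> j; rewrite mem_iota /= add0n => ltj.
  have : nth x0 s j \in X by rewrite XT inE.
  by rewrite inE index_uniq.
rewrite !inE in vX uX; move: uX; apply/negP; rewrite negbK.
pose B := [seq w <- iota 0 (size s) | entry (adj (@dom H) s) w (index v s)].
have /clr : (index v s, uncovered_seq (entry (adj (@dom H) s)) B)
    \in expansions (entry (adj (@dom H) s)) (iota 0 (size s)).
  by apply/mapP; exists (index v s); rewrite // mem_iota /= add0n.
rewrite /= vX => /allP; apply.
have inB y : dom y v -> index y s \in B.
  by move=> yv; rewrite mem_filter entryE yv mem_iota /= add0n.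
rewrite mem_filter inB // andbT; apply/hasPn => j; rewrite mem_filter mem_iota /= add0n => /andP[jv ltj].
have jE : j = index (nth x0 s j) s by rewrite index_uniq.
rewrite jE entryE in jv *; set z := nth x0 s j in jv *.
rewrite entryE; case: ifP => // zu; apply/negP => /allP covers.
have [||y yv /andP[uy yz]] := unc z; rewrite ?inE //.
rewrite inE in yv.
have := covers _ (inB _ yv); rewrite !entryE uy /= => /dom_asym.
by rewrite yz.
Qed.

Lemma beta_le_strong n : 1 < n -> beta n <= size (strong_tournaments n).
Proof.
move=> n1; rewrite betaE; apply: (@card_cls_le n false) => H; rewrite inE => /asboolP retH.
have := @realized_uncovered _ _ (@orient_irr false (tournament_of H))
  (@orientC false (tournament_of H)) (enum 'I_n) (enum_uniq 'I_n).
rewrite size_enum_ord => /(_ n1 (@retentive_uncovered _ _ retH false)) [s ps sL].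
by exists s; rewrite // mem_filter sL andbT; apply: (retentive_strong_mx retH).
Qed.

(** * Lower bounds *)

Lemma tau_in_unique (T : tournament) (C A : {set T}) :
  A \subset C -> A != set0 ->
  (forall v u, v \in A -> u \in tau_in (C :&: inN v) -> u \in A) ->
  (forall B : {set T}, B \subset C -> B != set0 ->
     (forall v u, v \in B -> u \in tau_in (C :&: inN v) -> u \in B) -> A \subset B) ->
  tau_in C = A.
Proof.
move=> sAC A0 clA minA; pose A' : {set induced C} := [set x | val x \in A].
have AE : [set val x | x in A'] = A.
  apply/setP=> x; apply/imsetP/idP => [[y + ->]|xA]; first by rewrite inE.
  by exists (@exist _ (fun z => z \in C) _ (subsetP sAC _ xA)); rewrite ?inE.
have retE (B : {set induced C}) : retentive B -> 
    [set val x | x in B] != set0 /\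
    forall v u, v \in [set val x | x in B] ->
      u \in tau_in (C :&: inN v) -> u \in [set val x | x in B].
  move=> /retentiveP[B0 clB]; rewrite imset_eq0; split=> // _ u /imsetP[v vB ->].
  by rewrite -val_inN -val_tau_in => /imsetP[w wv ->]; apply: imset_f; apply: clB wv.
rewrite /tau_in /tau_in_with; have [||_ ->] := @tau_unique (induced C) A'; last exact: AE.
  apply/retentiveP; split; first by rewrite -(imset_eq0 val) AE.
  move=> v u; rewrite !inE => vA uv; apply: clA vA _.
  by rewrite -val_inN -val_tau_in; apply: imset_f.
move=> B /retE[B0 clB]; have sBC : [set val x | x in B] \subset C.
  by apply/subsetP=> _ /imsetP[x _ ->]; exact: valP.
apply/subsetP=> x; rewrite inE => /(subsetP (minA _ sBC B0 clB)) /imsetP[y yB].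
by move=> /val_inj->.
Qed.

Lemma closure_sub (T : eqType) (E : seq (T * seq T)) n x (B : {pred T}) :
  {in E, forall e, e.1 \in B -> {subset e.2 <= B}} -> x \in B ->
  {subset closure E n x <= B}.
Proof.
move=> clB xB; elim: n => [|n IHn] /= y; first by rewrite inE => /eqP->.
rewrite mem_undup mem_cat => /orP[/flattenP[l /mapP[e]]|]; last exact: IHn.
by rewrite mem_filter => /andP[/IHn eB eE] ->; apply: clB eB y.
Qed.

(** By [closure_sub], each closure lies in every closed set containing its starting vertex, so the
    intersection [S] of all closures lies in every nonempty closed set. As [S] is itself checked to
    be closed, and nonempty unless [s] is empty, it is the unique minimal retentive set of a
    nonempty [s]. *)
Lemma tau_seq_correct k (T : tournament) (s S : seq T) : tau_seq (@dom T) k s = Some S ->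
  {subset S <= s} /\
  (tau_in [set x in s] = [set x in S] /\
  forall B : {set T}, B \subset [set x in s] -> B != set0 ->
     (forall v u, v \in B -> u \in tau_in ([set x in s] :&: inN v) -> u \in B) ->
     [set x in S] \subset B).
Proof.
have emptyP : {subset ([::] : seq T) <= [::]} /\
  (tau_in [set x in [::]] = [set x in [::] : seq T] /\
  forall B : {set T}, B \subset [set x in [::]] -> B != set0 ->
     (forall v u, v \in B -> u \in tau_in ([set x in [::]] :&: inN v) -> u \in B) ->
     [set x in [::] : seq T] \subset B).
  have E0 : [set x in [::] : seq T] = set0 by apply/setP=> x; rewrite !inE.
  split=> //; rewrite !E0; split=> [|B _ _ _]; last exact: sub0set.
  by apply/eqP; rewrite -subset0 tau_in_sub.
elim: k s S => [|k IHk] s S /=; first by case: s => // -[<-].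
set E := map _ s; case: ifP => // /allP someE; set E' := map _ E; set rs := map _ s.
set S' := filter _ s; case: ifP => // /andP[nonnil /allP clS] [<-] {S}.
have [s0|sn0] := boolP (nilp s); first by rewrite /S' (nilP s0).
have tE v : v \in s -> exists2 l, (v, l) \in E' &
    tau_in ([set x in s] :&: inN v) = [set x in l].
  move=> vs; pose t := tau_seq (@dom T) k [seq u <- s | dom u v].
  have tE : (v, t) \in E by apply/mapP; exists v.
  have := someE _ tE; case Et : t => [l|] //= _; exists l.
    by apply/mapP; exists (v, t); rewrite //= Et.
  have [_ [<- _]] := IHk _ _ Et; congr tau_in.
  by apply/setP=> x; rewrite !inE mem_filter andbC.
have E'E e : e \in E' -> e.1 \in s /\ tau_in ([set x in s] :&: inN e.1) = [set x in e.2].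
  case/mapP=> e0 e0E ->; have := someE _ e0E; case/mapP: e0E => v vs -> /=.
  case Et : tau_seq => [l|] //= _; split=> //; have [_ [<- _]] := IHk _ _ Et; congr tau_in.
  by apply/setP=> x; rewrite !inE mem_filter andbC.
have sS : {subset S' <= s} by move=> x; rewrite mem_filter => /andP[].
have minS (B : {set T}) : B \subset [set x in s] -> B != set0 ->
    (forall v u, v \in B -> u \in tau_in ([set x in s] :&: inN v) -> u \in B) ->
    [set x in S'] \subset B.
  move=> sB /set0Pn[v vB] clB; apply/subsetP=> u; rewrite inE mem_filter => /andP[/allP inrs _].
  have vs : v \in s by have := subsetP sB _ vB; rewrite inE.
  have : u \in closure E' (size s) v by apply: inrs; apply/mapP; exists v.
  apply: (@closure_sub _ _ _ _ [in B]) => // e /E'E[es eE] eB w we.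
  by apply: clB eB _; rewrite eE inE.
split=> //; split=> //; apply: tau_in_unique minS.
- by apply/subsetP=> x; rewrite !inE; exact: sS.
- move: nonnil; rewrite (negbTE sn0) /= => nS; apply/set0Pn.
  by case: S' nS {clS sS} => // x l _; exists x; rewrite inE mem_head.
move=> v u; rewrite inE => vS; have [l lE ->] := tE v (sS _ vS).
by have := clS _ lE; rewrite /= vS inE => /allP clv /clv; rewrite inE.
Qed.

Definition mx_rel n (M : mx) : rel 'I_n := fun x y => entry M x y.

(* Unlike [enum 'I_n], this enumeration computes. *)
Fixpoint ords n : seq 'I_n :=
  if n is m.+1 then ord0 :: [seq lift ord0 i | i <- ords m] else [::].

Lemma mem_ords n (i : 'I_n) : i \in ords n.
Proof.
elim: n i => [[]//|n IHn] i; rewrite inE; case: (unliftP ord0 i) => [j|] ->.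
  by rewrite map_f ?orbT.
by rewrite eqxx.
Qed.

(** The first test forces [M] to be an [n] by [n] matrix, the second makes it a tournament, and the
    third says that its tau is the whole vertex set. *)
Definition retentive_mx n (M : mx) : bool :=
  [&& adj (entry M) (iota 0 n) == M,
      all (fun i => all (fun j =>
        if i == j then ~~ entry M i j else entry M i j == ~~ entry M j i)
        (iota 0 n)) (iota 0 n)
    & if tau_seq (@mx_rel n M) n (ords n) is Some V
      then all (fun i => i \in V) (ords n) else false].

Lemma retentive_mxP n M : 0 < n -> retentive_mx n M ->
  exists2 H : tournament_on n, retentive_tournament (tournament_of H) &
    adj (@dom (tournament_of H)) (enum 'I_n) = M.
Proof.
move=> n0 /and3P[/eqP ME /allP tourM tauM].
have relM (x y : 'I_n) : if x == y then ~~ mx_rel M x y else mx_rel M x y == ~~ mx_rel M y x.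
  have inI (z : 'I_n) : (z : nat) \in iota 0 n by rewrite mem_iota /= add0n.
  by have /allP/(_ _ (inI y)) := tourM _ (inI x).
pose D := [set p : 'I_n * 'I_n | mx_rel M p.1 p.2].
have DE x y : ((x, y) \in D) = mx_rel M x y by rewrite inE.
have DP : is_tournament (fun x y => (x, y) \in D).
  apply/andP; split; apply/forallP=> x; apply/forallP=> y; rewrite !DE; move: (relM x y).
    by case: eqP => [-> /negbTE-> //|_ /eqP->]; rewrite implybb.
  by case: eqP => //= _ /eqP->; case: mx_rel.
exists (exist _ D DP).
  set H := tournament_of _.
  have domE : @dom H = mx_rel M by apply/funext => x; apply/funext => y; rewrite /= DE.
  move: tauM; rewrite -domE; case Et : tau_seq => [S|] // /allP allS.
  have [_ [_ minS]] := @tau_seq_correct n H (ords n) S Et.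
  have full : [set x in ords n] = [set: 'I_n] by apply/setP=> x; rewrite !inE mem_ords.
  have fullS : [set x in S] = [set: 'I_n].
    by apply/setP=> x; rewrite !inE allS // mem_ords.
  exists H, setT; split; last first.
    exists val => //; exists (fun x => @exist _ (fun z => z \in [set: H]) x (in_setT x)) => //.
    by move=> x; apply: val_inj.
  apply/minsetP; split.
    by apply/retentiveP; split=> // ; apply/set0Pn; exists (Ordinal n0); rewrite inE.
  move=> B /retentiveP[B0 clB] _; apply/eqP; rewrite eqEsubset subsetT /= -fullS.
  apply: minS => //; first by rewrite full subsetT.
  by move=> v u vB; rewrite full setTI; exact: clB.
rewrite -[RHS]ME -val_enum_ord; apply/esym/adj_map => x y.
by rewrite /= DE.
Qed.

(** * Invariance of [invariantN] under reordering of the vertices *)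

Section Invariant.
Variables (T : eqType) (d : rel T).
Implicit Types s t : seq T.

Lemma nat_of_succN a : nat_of_bin (N.succ a) = (nat_of_bin a).+1.
Proof. by rewrite -N.add_1_l nat_of_addN. Qed.

Lemma nat_of_countN s x : nat_of_bin (countN [seq d x y | y <- s]) = outdeg d s x.
Proof.
by elim: s => //= y s <-; case: (d x y); rewrite ?nat_of_succN.
Qed.

Lemma nat_of_interN s x u : nat_of_bin (interN [seq d x y | y <- s] [seq d u y | y <- s]) =
  count (fun y => d x y && d u y) s.
Proof.
by elim: s => //= y s <-; case: (_ && _); rewrite ?nat_of_succN.
Qed.

Definition key s x : nat :=
  \sum_(u <- s | d x u) (3 * outdeg d s u + count (fun y => d x y && d u y) s) ^ 3.

Lemma keyN_cons row b cur n r rows :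
  keyN row (b :: cur) ((n, r) :: rows) =
  if b then let k := (3 * n + interN row r)%num in (k * k * k + keyN row cur rows)%num
  else keyN row cur rows.
Proof. by []. Qed.

Lemma nat_of_keyN s t x :
  nat_of_bin (keyN [seq d x y | y <- s] [seq d x y | y <- t]
    [seq (countN r, r) | r <- [seq [seq d u y | y <- s] | u <- t]]) =
  \sum_(u <- t | d x u) (3 * outdeg d s u + count (fun y => d x y && d u y) s) ^ 3.
Proof.
elim: t => [|u t IHt]; first by rewrite big_nil.
rewrite big_cons -IHt !map_cons keyN_cons; case: (d x u) => //.
rewrite nat_of_addN; congr (_ + _); rewrite !nat_of_mulN nat_of_addN nat_of_mulN.
by rewrite nat_of_countN nat_of_interN !expnS expn0 muln1 mulnA.
Qed.

Lemma nat_of_invariantN s : nat_of_bin (invariantN (adj d s)) = \sum_(x <- s) key s x ^ 2.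
Proof.
rewrite /invariantN; set rows := map _ _.
have H t : nat_of_bin (foldr (fun r a => let k := keyN r r rows in (k * k + a)%num) 0%num
    [seq [seq d x y | y <- s] | x <- t]) = \sum_(x <- t) key s x ^ 2.
  elim: t => [|x t IHt]; first by rewrite big_nil.
  rewrite big_cons -IHt /= nat_of_addN nat_of_mulN; congr (_ + _).
  by rewrite /rows nat_of_keyN -mulnn.
exact: H.
Qed.

Lemma perm_invariantN s t : perm_eq s t -> invariantN (adj d s) = invariantN (adj d t).
Proof.
move=> st; apply: (can_inj nat_of_binK); rewrite !nat_of_invariantN (perm_big _ st) /=.
apply: eq_bigr => x _; congr (_ ^ 2); rewrite /key (perm_big _ st) /=.
apply: eq_bigr => u _; rewrite /outdeg.
by have /seq.permP p := st; rewrite !p.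
Qed.

End Invariant.

(** The invariant is constant on a class, so [h] may read it off any representative. Distinct
    invariants therefore come from distinct classes. *)
Lemma size_le_beta n L : 0 < n -> all (retentive_mx n) L ->
  uniq [seq invariantN M | M <- L] -> size L <= beta n.
Proof.
move=> n0 /allP okL uL; rewrite betaE -(size_map invariantN).
pose h (C : {set tournament_on n}) :=
  if [pick H in C] is Some H then invariantN (adj (@dom (tournament_of H)) (enum 'I_n)) else 0%num.
rewrite cardE -(size_map h); apply: uniq_leq_size uL _ => _ /mapP[M ML ->].
have [H retH HM] := retentive_mxP n0 (okL M ML).
apply/mapP; exists (cls H); first by rewrite mem_enum; apply: imset_f; rewrite inE; apply/asboolP.
rewrite /h; case: pickP => [K|/(_ H)]; last first.
  by rewrite mem_cls => /asboolPn[]; exact: isomorphic_refl.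
rewrite mem_cls => /asboolP HK.
have [t pt] := @isomorphic_adj false (tournament_of H) _ (enum 'I_n) (perm_refl _) HK.
have -> : adj (@orient false (tournament_of H)) (enum 'I_n) = M by exact: HM.
by move=> <-; apply: perm_invariantN.
Qed.

(** The list is an argument, so that call by value enumerates it once for all three tests. *)
Definition strong_check n m (L : seq mx) : bool :=
  [&& size L == m, all (retentive_mx n) L & uniq [seq invariantN M | M <- L]].

Lemma beta_strong n m : 1 < n -> strong_check n m (strong_tournaments n) -> beta n = m.
Proof.
move=> n1 /and3P[/eqP<- okG uG]; apply/eqP.
by rewrite eqn_leq beta_le_strong // size_le_beta // ltnW.
Qed.

Lemma strong_check6 : strong_check 6 2 (strong_tournaments 6).
Proof. vm_cast_no_check (erefl true). Qed.

Lemma strong_check7 : strong_check 7 26 (strong_tournaments 7).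
Proof. vm_cast_no_check (erefl true). Qed.

Theorem theorem3 :
  beta 6 = 2 /\ beta 7 = 26 /\ beta 8 <= 395 /\
  beta 9 <= nat_of_bin 30596%num /\ beta 10 <= nat_of_bin 3881175%num.
Proof.
split; first exact: (@beta_strong 6 2 isT strong_check6).
split; first exact: (@beta_strong 7 26 isT strong_check7).
split; first exact: (leq_trans (@beta_le_uncovered 8 isT) size_uncovered8).
split; first exact: (leq_trans beta9_le (leq_nat_of_bin bound9_computed)).
exact: (leq_trans beta10_le (leq_nat_of_bin bound10_computed)).
Qed.
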